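(* For $p\ge2$ and real $c$ with $c^2<1/(p-1)$, let $X^{(p)}(c)=(e_1,e_2,\dots,e_{p-1},X_p(c))$ be the $p\times p$ matrix whose first $p-1$ columns are the canonical basis vectors $e_1,\dots,e_{p-1}$ of $\mathbb R^p$ and whose last column is $X_p(c)=(c,c,\dots,c,\sqrt{1-(p-1)c^2})^T$. For every fixed $\alpha\in(0,1)$, with $\sigma^2$ known, the PoSI1 constants for the predictor $X_p(c)$ satisfy $$\lim_{p\to\infty}\ \sup_{c^2<1/(p-1)}\ \frac{K_{p\cdot}(X^{(p)}(c),\alpha)}{\sqrt p}=0.6363\ldots,$$ i.e. the limit exists and is a number whose decimal expansion begins $0.6363$.
   Context: PoSI1 constant for known variance ($\sigma=1$, $r=\infty$) and the universe of all submodels containing the predictor $p$. Let $X=(X_1,\dots,X_p)$ be a nonsingular real $p\times p$ matrix. For $M\subset\{1,\dots,p\}$ with $p\in M$, $X_{p\cdot M}\in\mathbb R^p$ is the residual vector of $X_p$ after orthogonal projection onto the span of $\{X_k:k\in M\setminus\{p\}\}$ (equal to $X_p$ if $M=\{p\}$), and $\bar l_{p\cdot M}=X_{p\cdot M}/\|X_{p\cdot M}\|$. With $Z\sim N(0,I_p)$, $K_{p\cdot}(X,\alpha)$ is the minimal $K$ such that $$P\Bigl[\max_{M\subset\{1,\dots,p\}:\ p\in M}|\bar l_{p\cdot M}^TZ|\le K\Bigr]\ge1-\alpha .$$ *)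

(* Defs.v *)
From HB Require Import structures.
From mathcomp Require Import all_boot all_order all_algebra.
From mathcomp Require Import all_classical all_reals all_analysis.
From mathcomp Require Import measurable_realfun.
Set Implicit Arguments.
Unset Strict Implicit.
Unset Printing Implicit Defensive.
Import Order.TTheory GRing.Theory Num.Theory.
Import numFieldNormedType.Exports.
Local Open Scope classical_set_scope.
Local Open Scope ring_scope.

Definition cons_tuple (T : Type) n (x : (T * n.-tuple T)%type) : n.+1.-tuple T :=
  [tuple of x.1 :: x.2].

Lemma measurable_cons_tuple d (T : measurableType d) n :
  measurable_fun [set: (T * n.-tuple T)%type] (@cons_tuple T n).
Proof. exact: measurable_cons. Qed.

HB.instance Definition _ d (T : measurableType d) n :=
  isMeasurableFun.Build _ _ _ _ (@cons_tuple T n) (@measurable_cons_tuple d T n).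

(* N(0, I_n), as the n-fold product of N(0, 1); see std_gauss_box. *)
Fixpoint std_gauss (R : realType) (n : nat) :
    probability (n.-tuple (measurableTypeR R)) R :=
  if n is m.+1 then
    distribution (normal_prob 0 1 \x std_gauss R m)%E
      (@cons_tuple (measurableTypeR R) m
        : {mfun (measurableTypeR R * m.-tuple (measurableTypeR R))%type >->
                m.+1.-tuple (measurableTypeR R)})
  else dirac [tuple].

Lemma std_gauss_box (R : realType) n (B : 'I_n -> set (measurableTypeR R)) :
  (forall i, measurable (B i)) ->
  std_gauss R n [set z | forall i, B i (tnth z i)] =
  (\prod_(i < n) normal_prob 0 1 (B i))%E.
Proof.
elim: n B => [|n IH] B mB /=.
  by rewrite big_ord0 diracE mem_set// => -[].
rewrite big_ord_recl -IH; last by move=> i; exact: mB.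
rewrite /distribution /pushforward /= -product_measure1E//.
- congr (product_measure1 _ _ _); apply/seteqP; split => -[x z] /=.
  + move=> H; split; first exact: (H ord0).
    move=> i; have := H (lift ord0 i).
    by rewrite /cons_tuple tnthS.
  + move=> [H0 H] i; have [j ->|->] := unliftP ord0 i.
      by rewrite /cons_tuple tnthS; exact: H.
    exact: H0.
- rewrite [X in measurable X](_ : _ = \bigcap_(i in [set: 'I_n])
    ((fun z => tnth z i) @^-1` B (lift ord0 i))); last first.
    by apply/seteqP; split => z /= H i; [move=> _|]; apply: H.
  apply: fin_bigcap_measurable => // i _.
  by rewrite -[X in measurable X]setTI; apply: measurable_tnth.
Qed.

(* Vectors of R^p are row vectors here, since MathComp's %MS-subspaces are row
   spaces; `|v| on matrices would be the sup norm, hence these definitions. *)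
Definition dot (R : realType) p (u v : 'rV[R]_p) : R :=
  \sum_(i < p) u 0 i * v 0 i.

Definition norm2 (R : realType) p (v : 'rV[R]_p) : R := Num.sqrt (dot v v).

Definition column (R : realType) p (X : 'M[R]_p) (k : 'I_p) : 'rV[R]_p :=
  (col k X)^T.

Definition span_columns (R : realType) p (X : 'M[R]_p) (A : {set 'I_p})
    : 'M[R]_p :=
  (\sum_(k in A) <<column X k>>)%MS.

(* Orthogonal projection onto the row space of U: kermx U^T is the orthogonal
   complement. *)
Definition orth_proj (R : realType) p (U : 'M[R]_p) : 'M[R]_p :=
  proj_mx U (kermx U^T).

Definition residual (R : realType) p (X : 'M[R]_p) (j : 'I_p)
    (M : {set 'I_p}) : 'rV[R]_p :=
  column X j - column X j *m orth_proj (span_columns X (M :\ j)%SET).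

Lemma dotE (R : realType) p (u v : 'rV[R]_p) : dot u v = (u *m v^T) 0 0.
Proof. by rewrite mxE; apply: eq_bigr => i _; rewrite mxE. Qed.

Lemma dot_eq0 (R : realType) p (v : 'rV[R]_p) : (dot v v == 0) = (v == 0).
Proof.
apply/idP/eqP => [|->]; last first.
  by apply/eqP; apply: big1 => i _; rewrite mxE mul0r.
rewrite /dot psumr_eq0 => [/allP H|i _]; last by rewrite -expr2 sqr_ge0.
apply/rowP => i; rewrite mxE; apply/eqP.
by have := H i (mem_index_enum _); rewrite mulf_eq0 orbb.
Qed.

Lemma capmx_orth (R : realType) p (U : 'M[R]_p) : (U :&: kermx U^T = 0)%MS.
Proof.
apply/eqP/rowV0P => v; rewrite sub_capmx => /andP[/submxP[w vE] /sub_kermxP v0].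
apply/eqP; rewrite -dot_eq0 dotE {2}vE trmx_mul mulmxA v0.
by rewrite mul0mx mxE.
Qed.

Lemma residual_sub (R : realType) p (X : 'M[R]_p) j M :
  (column X j - residual X j M <= span_columns X (M :\ j)%SET)%MS.
Proof. by rewrite opprB addrC subrK proj_mx_sub. Qed.

Lemma residual_orth (R : realType) p (X : 'M[R]_p) j M k :
  k \in (M :\ j)%SET -> dot (residual X j M) (column X k) = 0.
Proof.
move=> kM; set U := span_columns X (M :\ j)%SET.
have kU : (column X k <= U)%MS.
  by apply: (submx_trans _ (sumsmx_sup _ kM (submx_refl _))); rewrite genmxE.
have full : (column X j <= U + kermx U^T)%MS.
  apply: submx_full; rewrite /row_full mxrank_disjoint_sum ?capmx_orth//.
  by rewrite mxrank_ker mxrank_tr subnKC ?rank_leq_row.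
have /sub_kermxP r0 := proj_mx_compl_sub full.
have /submxP[w ->] := kU.
by rewrite dotE trmx_mul mulmxA r0 mul0mx mxE.
Qed.

Definition unit_residual (R : realType) p (X : 'M[R]_p) (j : 'I_p)
    (M : {set 'I_p}) : 'rV[R]_p :=
  (norm2 (residual X j M))^-1 *: residual X j M.

(* The terms are nonnegative and M = {j} always occurs, so that the default
   value 0 of the iterated maximum is harmless. *)
Definition max_stat (R : realType) p (X : 'M[R]_p) (j : 'I_p)
    (z : p.-tuple (measurableTypeR R)) : R :=
  \big[Num.max/0]_(M : {set 'I_p} | j \in M)
    `|dot (unit_residual X j M) (\row_i tnth z i)|.

(* This infimum is a minimum: see PoSI1_const_min. *)
Definition PoSI1_const (R : realType) p (X : 'M[R]_p) (j : 'I_p) (alpha : R)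
    : R :=
  inf [set K : R |
    ((1 - alpha)%:E <= std_gauss R p [set z | (max_stat X j z <= K)%R])%E].

Lemma measurable_max_stat (R : realType) p (X : 'M[R]_p) j :
  measurable_fun [set: p.-tuple (measurableTypeR R)]
    (max_stat X j : _ -> measurableTypeR R).
Proof.
rewrite /max_stat; elim: (index_enum _) => [|M s IH].
  by under eq_fun do rewrite big_nil; exact: measurable_cst.
case jM: (j \in M); last first.
  rewrite (_ : (fun _ => _) = fun z => \big[Num.max/0]_(M <- s | j \in M)
    `|dot (unit_residual X j M) (\row_i tnth z i)|)//.
  by apply/funext => z; rewrite big_cons jM.
rewrite (_ : (fun _ => _) = fun z => Num.max
  `|dot (unit_residual X j M) (\row_i tnth z i)|
  (\big[Num.max/0]_(M <- s | j \in M)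
    `|dot (unit_residual X j M) (\row_i tnth z i)|)); last first.
  by apply/funext => z; rewrite big_cons jM.
apply: measurable_maxr => //.
apply: (@measurableT_comp _ _ _ _ _ _ (@Num.norm R R)) => //.
apply: measurable_sum => i; apply: measurable_funM => //.
by under eq_fun do rewrite mxE; exact: measurable_tnth.
Qed.

Lemma PoSI1_const_min (R : realType) p (X : 'M[R]_p) (j : 'I_p) (alpha : R) :
  0 < alpha < 1 ->
  let cov K := std_gauss R p [set z | max_stat X j z <= K] in
  ((1 - alpha)%:E <= cov (PoSI1_const X j alpha))%E /\
  (forall K, ((1 - alpha)%:E <= cov K)%E -> PoSI1_const X j alpha <= K).
Proof.
move=> /andP[a0 a1] cov; set S := [set K | ((1 - alpha)%:E <= cov K)%E].
have mle K : measurable [set z | max_stat X j z <= K].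
  rewrite (_ : [set _ | _] =
    (max_stat X j : _ -> measurableTypeR R) @^-1` `]-oo, K]%classic).
    rewrite -[X in measurable X]setTI.
    by apply: (measurable_max_stat X j); [exact: measurableT|exact: measurable_itv].
  by apply/seteqP; split => z /=; rewrite in_itv.
have lbS : lbound S 0.
  move=> K SK; rewrite leNgt; apply/negP => K0; move: SK; rewrite /S /=.
  rewrite (_ : cov K = 0%E); first by rewrite lee_fin leNgt subr_gt0 a1.
  rewrite /cov (_ : [set _ | _] = set0) ?measure0//.
  apply/seteqP; split => z //=; apply/negP; rewrite -ltNge.
  by apply: lt_le_trans K0 _; exact: bigmax_ge_id.
have hlb : has_lbound S by exists 0.
have neS : S !=set0.
  have covT : cov n%:R @[n --> \oo] --> (1 : \bar R)%E.
    rewrite -(@probability_setT _ _ _ (std_gauss R p)).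
    rewrite (_ : [set: _] = \bigcup_n [set z | max_stat X j z <= n%:R]).
      apply: nondecreasing_cvg_mu => //.
        exact: bigcup_measurable.
      move=> m n mn; apply/subsetPset => z /= /le_trans; apply.
      by rewrite ler_nat.
    apply/seteqP; split => // z _.
    by exists (Num.truncn (max_stat X j z)).+1 => //=; exact/ltW/truncnS_gt.
  have /covT : nbhs (1 : \bar R)%E [set x | ((1 - alpha)%:E < x)%E].
    apply: open_nbhs_nbhs; split; first exact: open_ereal_gt_ereal.
    by rewrite /= lte_fin ltrBlDr ltrDl.
  by move=> /= -[N _ /(_ N (leqnn N)) /ltW HN]; exists N%:R.
split; last by move=> K SK; exact: ge_inf.
have covI : cov (inf S + n.+1%:R^-1) @[n --> \oo] --> cov (inf S).
  rewrite {2}/cov (_ : [set _ | _] =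
    \bigcap_n [set z | max_stat X j z <= inf S + n.+1%:R^-1]).
    apply: nonincreasing_cvg_mu => //.
    - by rewrite (le_lt_trans (probability_le1 _ _)) ?ltry.
    - exact: bigcap_measurable.
    - move=> m n mn; apply/subsetPset => z /= /le_trans; apply.
      by rewrite lerD2l lef_pV2 ?posrE// ler_nat.
  apply/seteqP; split => z /= H.
    by move=> n _ /=; rewrite (le_trans H)// lerDl.
  apply/ler_addgt0Pr => e e0.
  have := H (Num.truncn e^-1) Logic.I => /= /le_trans; apply.
  rewrite lerD2l -[leRHS]invrK lef_pV2 ?posrE ?invr_gt0//.
  exact/ltW/truncnS_gt.
apply: (cvge_to_ge covI); apply: nearW => n.
have [s Ss sK] : exists2 s, S s & s < inf S + n.+1%:R^-1.
  by apply: inf_lt; rewrite // ltrDl.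
apply: le_trans Ss _; apply: le_measure; rewrite ?inE//.
by move=> z /= /le_trans; apply; exact: ltW.
Qed.

(* The matrix (e_1, ..., e_m, (c, ..., c, sqrt(1 - m c^2))^T) of size p = m + 1;
   the predictor p has index ord_max. *)
Definition orth_design (R : realType) m (c : R) : 'M[R]_m.+1 :=
  \matrix_(i, k)
    if k == ord_max then
      if i == ord_max then Num.sqrt (1 - m%:R * c ^+ 2) else c
    else (i == k)%:R.

Lemma orth_design_unit (R : realType) m (c : R) :
  m%:R * c ^+ 2 < 1 -> orth_design m c \in unitmx.
Proof.
move=> mc; rewrite unitmxE unitfE -det_tr det_trig.
  apply/prodf_neq0 => i _; rewrite !mxE.
  case: ifP => [->|_]; last by rewrite eqxx oner_neq0.
  by apply/lt0r_neq0; rewrite sqrtr_gt0 subr_gt0.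
apply/is_trig_mxP => i k ik; rewrite !mxE.
rewrite ifN; first by rewrite gt_eqF.
by apply: contraTneq ik => ->; rewrite -leqNgt -ltnS.
Qed.

(* Main.v *)
Require Import Defs.
From mathcomp Require Import all_boot all_order all_algebra.
From mathcomp Require Import all_classical all_reals all_analysis.
From mathcomp Require Import ring lra measurable_realfun.
Import Order.TTheory GRing.Theory Num.Theory.
Import numFieldNormedType.Exports.
Local Open Scope classical_set_scope.
Local Open Scope ring_scope.

(** Removing the canonical predictors of M from X_p(c) kills their coordinates,
so the statistic is the maximum over all U in {1, ..., p-1} of
|c sum_U Z_i + s Z_p| / sqrt (c^2 |U| + s^2), where s is the last coordinate of
X_p(c). As |c| sqrt |U| and s are both at most the denominator, this is at most
max_U |sum_U Z_i| / sqrt |U| + |Z_p|, whatever c is; and when c = s = 1 / sqrt p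
it is exactly the maximum of |sum_W Z_i| / sqrt |W| over the W containing p.

The maximum over U has a one-parameter dual. For K > 0 and k > 0, K sqrt k is
the minimum over a > 0 of a k + K^2 / (4 a), and the largest value of
sum_U (z_i - a) over U is the hinge sum H(a) = sum_i max (z_i - a, 0); hence
  max_U max (sum_U z_i, 0)^2 / (4 |U|) = sup over a >= 0 of a H(a)
(the two halves are used in [subset_sum_le] and [max_stat_ge]). By the law of
large numbers H(a) / p tends to g(a) = E max (Z - a, 0) ([excess]), and
a H(a) / p stays below S = sup_a a g(a) up to a small error uniformly in a
([whp_hinge_uniform]). So, with L = 2 sqrt S, the statistic divided by sqrt p is
at most L + o(1) with high probability for all c at once ([PoSI1_upper]), and at
least L - o(1) for c = 1 / sqrt p ([PoSI1_lower]). These events have probability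
tending to one, so every quantile obeys the same bounds: this is why L does not
depend on alpha.

For the digits of L one writes, for a >= 0,
  g(a) + a / 2 = (1 + int_0^a (a - x) exp (- x^2 / 2) dx) / sqrt (2 pi),
replaces the exponential by its alternating Taylor polynomials, and encloses pi
through the sign of cosine near pi / 2. The maximum of a g(a) is about
0.101228, near a = 0.612, while the window [0.6363, 0.6364) for L amounts to
0.1012194 < S < 0.1012512 up to rounding. *)

(** * Integration against the standard normal law *)

Section gaussian.
Context {R : realType}.
Local Notation mu := (@lebesgue_measure R).
Local Notation gamma := (@normal_prob R 0 1).
Local Notation phi := (@normal_pdf R 0 1).

Lemma integral_normal_prob (f : measurableTypeR R -> \bar R) :
  measurable_fun setT f -> (forall x, 0 <= f x)%E ->
  (\int[gamma]_x f x = \int[mu]_x (f x * (phi x)%:E))%E.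
Proof.
move=> mf f0; have dom := @normal_prob_dominates R 0 1.
rewrite -(Radon_Nikodym_SigmaFinite.change_of_variables dom)//.
apply: ae_eq_integral => //.
- apply: emeasurable_funM => //.
  exact: measurable_int (Radon_Nikodym_SigmaFinite.f_integrable dom).
- apply: emeasurable_funM => //; apply/measurable_EFinP.
  exact: measurable_normal_pdf.
- apply: ae_eqe_mul2l => /=; apply: integral_ae_eq => //=.
  + exact: Radon_Nikodym_SigmaFinite.f_integrable.
  + by apply/measurable_EFinP; exact: measurable_normal_pdf.
  + by move=> E _ mE; rewrite -Radon_Nikodym_SigmaFinite.f_integral.
Qed.

Lemma normal_mgf (b : R) :
  (\int[gamma]_x (expR (b * x))%:E = (expR (b ^+ 2 / 2))%:E)%E.
Proof.
have mexp : measurable_fun setT (fun x : measurableTypeR R => expR (b * x)).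
  by apply: measurableT_comp => //; exact: measurable_funM.
rewrite integral_normal_prob; last 2 first.
- exact/measurable_EFinP.
- by move=> x; rewrite lee_fin expR_ge0.
under eq_integral => x _.
  have -> : ((expR (b * x))%:E * (phi x)%:E =
    (expR (b ^+ 2 / 2))%:E * (normal_pdf b 1 x)%:E)%E.
    rewrite -!EFinM; congr EFin.
    rewrite !normal_pdfE ?oner_neq0// /normal_fun mulrCA [RHS]mulrCA.
    by congr (_ * _); rewrite -!expRD; congr expR; field.
  over.
rewrite ge0_integralZl//.
- by rewrite integral_normal_pdf mule1.
- by apply/measurable_EFinP; exact: measurable_normal_pdf.
- by move=> x _; rewrite lee_fin normal_pdf_ge0.
Qed.

(** Symmetry lets every statement about the sums of the coordinates be used for
their opposites, as the absolute value in the statistic requires. *)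
Lemma integral_normalN (f : measurableTypeR R -> \bar R) :
  measurable_fun setT f -> (forall x, 0 <= f x)%E ->
  (\int[gamma]_x f (- x)%R = \int[gamma]_x f x)%E.
Proof.
move=> mf f0.
have mN : measurable_fun setT (-%R : measurableTypeR R -> measurableTypeR R).
  exact: oppr_measurable.
rewrite !integral_normal_prob//; last exact: measurableT_comp mf _.
have mF : measurable_fun setT (fun x : measurableTypeR R => f x * (phi x)%:E)%E.
  apply: emeasurable_funM => //; apply/measurable_EFinP.
  exact: measurable_normal_pdf.
have F0 x : (0 <= f x * (phi x)%:E)%E by rewrite mule_ge0// lee_fin normal_pdf_ge0.
transitivity (\int[mu]_x ((fun x => f x * (phi x)%:E) \o -%R) x)%E.
  apply: eq_integral => x _ /=; congr (_ * _%:E)%E.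
  by rewrite !normal_pdfE ?oner_neq0// /normal_fun !subr0 sqrrN.
rewrite -[LHS](@ge0_integral_pushforward _ _ _ _ _ _ mN mu setT)//.
apply: eq_measure_integral => //= A mA _; rewrite /pushforward.
by have := lebesgue_measureN mA; rewrite /pushforward => ->.
Qed.

End gaussian.

(** * Second moment of a sum of independent coordinates *)

Section product.
Context {R : realType}.
Local Notation gamma := (@normal_prob R 0 1).

Definition tuple_sum (h : R -> R) {n} (z : n.-tuple (measurableTypeR R)) : R :=
  \sum_(i < n) h (tnth z i).

Lemma measurable_tuple_sum (h : measurableTypeR R -> measurableTypeR R) n :
  measurable_fun setT h ->
  measurable_fun setT (tuple_sum h (n := n) : _ -> measurableTypeR R).
Proof.
move=> mh; apply: measurable_sum => i.
by apply: measurableT_comp => //; exact: measurable_tnth.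
Qed.

Lemma tuple_sum_le (h k : R -> R) n (z : n.-tuple (measurableTypeR R)) :
  (forall x, h x <= k x) -> tuple_sum h z <= tuple_sum k z.
Proof. by move=> hk; apply: ler_sum => i _. Qed.

Lemma tuple_sumZ (c : R) (h : R -> R) n (z : n.-tuple (measurableTypeR R)) :
  c * tuple_sum h z = tuple_sum (fun x => c * h x) z.
Proof. exact: mulr_sumr. Qed.

Lemma tuple_sum_ge0 (h : R -> R) n (z : n.-tuple (measurableTypeR R)) :
  (forall x, 0 <= h x) -> 0 <= tuple_sum h z.
Proof. by move=> h0; apply: sumr_ge0 => i _. Qed.

Section variance.
Variable h : measurableTypeR R -> measurableTypeR R.
Hypothesis mh : measurable_fun setT h.
Hypothesis ih : gamma.-integrable setT (EFin \o h).
Hypothesis h0 : (\int[gamma]_x (h x)%:E = 0)%E.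
Hypothesis ih2 : gamma.-integrable setT (fun x => (h x ^+ 2)%:E).

(** The step of the induction below: the cross term vanishes because h is
centred, and the shift s is the sum over the remaining coordinates. *)
Lemma integral_sqr_shift (s : R) :
  (\int[gamma]_x ((h x + s) ^+ 2)%:E =
   \int[gamma]_x (h x ^+ 2)%:E + (s ^+ 2)%:E)%E.
Proof.
have is2 : gamma.-integrable setT (cst (s ^+ 2)%:E).
  exact: finite_measure_integrable_cst.
have ish : gamma.-integrable setT (fun x => (s *+ 2)%:E * (h x)%:E)%E.
  exact: integrableZl.
transitivity (\int[gamma]_x ((h x ^+ 2)%:E +
    ((s *+ 2)%:E * (h x)%:E + cst (s ^+ 2)%:E x)))%E.
  apply: eq_integral => x _.
  by rewrite -EFinM -!EFinD; congr EFin; ring.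
rewrite integralD//=; last exact: integrableD.
rewrite integralD//= integralZl//= h0 mule0 add0e integral_cst//=.
by rewrite [X in (_ * X)%E]probability_setT mule1.
Qed.

(** Integrating first over the new coordinate keeps every integrand nonnegative,
so that Tonelli's theorem is enough and the sums need not be shown integrable. *)
Lemma integral_sqr_tuple_sum n :
  (\int[std_gauss R n]_z ((tuple_sum h z) ^+ 2)%:E =
   n%:R%:E * \int[gamma]_x (h x ^+ 2)%:E)%E.
Proof.
elim: n => [|n IH].
  rewrite mul0e; apply: integral0_eq => z _.
  by rewrite /tuple_sum big_ord0 expr0n.
have mS2 m : measurable_fun setT (fun z : m.-tuple (measurableTypeR R) =>
    ((tuple_sum h z) ^+ 2)%:E).
  apply/measurable_EFinP; apply: measurable_funX.
  exact: measurable_tuple_sum.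
rewrite /= ge0_integral_distribution//; last 2 first.
- exact: mS2.
- by move=> z; rewrite lee_fin sqr_ge0.
rewrite fubini_tonelli2//; last 2 first.
- exact: measurableT_comp (mS2 n.+1) _.
- by move=> z; rewrite lee_fin sqr_ge0.
rewrite /fubini_G/=.
under eq_integral => z _.
  under eq_integral => x _.
    rewrite /tuple_sum big_ord_recl /=.
    have -> : \sum_(i < n) h (tnth (Defs.cons_tuple (x, z)) (lift ord0 i)) =
        tuple_sum h z.
      by apply: eq_bigr => i _; rewrite /Defs.cons_tuple tnthS.
    over.
  rewrite /= integral_sqr_shift; over.
rewrite ge0_integralD//; last 3 first.
- by move=> z _; apply: integral_ge0 => x _; rewrite lee_fin sqr_ge0.
- by move=> z _; rewrite lee_fin sqr_ge0.
- exact: mS2.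
rewrite IH integral_cst// [X in (_ * X)%E]probability_setT mule1.
by rewrite -{1}[X in (X + _)%E]mul1e -ge0_muleDl// -EFinD -natr1 addrC.
Qed.

End variance.
End product.

(** * Events of probability tending to one, and the weak law *)

Section whp.
Context {R : realType}.
Local Notation gamma := (@normal_prob R 0 1).

(** Convergence to one of the probability of Q, with an explicit measurable
exceptional set: Q itself may be an uncountable conjunction, whose measurability
is then never an issue. *)
Definition whp (Q : forall n, n.-tuple (measurableTypeR R) -> Prop) :=
  forall eta : R, 0 < eta -> \forall n \near \oo,
    exists B : set (n.-tuple (measurableTypeR R)),
      [/\ measurable B, (std_gauss R n B <= eta%:E)%E & forall z, ~ B z -> Q n z].

Lemma whp_le (Q Q' : forall n, n.-tuple (measurableTypeR R) -> Prop) :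
  (\forall n \near \oo, forall z, Q n z -> Q' n z) -> whp Q -> whp Q'.
Proof.
move=> QQ' wQ eta /wQ; apply: filterS2 QQ' => n QQ'n [B [mB PB BQ]].
by exists B; split => // z /BQ /QQ'n.
Qed.

Lemma whp_and (Q Q' : forall n, n.-tuple (measurableTypeR R) -> Prop) :
  whp Q -> whp Q' -> whp (fun n z => Q n z /\ Q' n z).
Proof.
move=> wQ wQ' eta eta0; have eta2 : 0 < eta / 2 by rewrite divr_gt0.
apply: filterS2 (wQ _ eta2) (wQ' _ eta2) => n [B [mB PB BQ]] [B' [mB' PB' BQ']].
exists (B `|` B'); split; first exact: measurableU.
  apply: le_trans (measureU2 _ mB mB') _.
  by rewrite [eta]splitr EFinD; apply: leeD.
by move=> z /not_orP[Bz B'z]; split; [exact: BQ|exact: BQ'].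
Qed.

Lemma whp_ltn (Q : nat -> forall n, n.-tuple (measurableTypeR R) -> Prop) N :
  (forall j, whp (Q j)) -> whp (fun n z => forall j, (j < N)%N -> Q j n z).
Proof.
move=> wQ; elim: N => [|N IH].
  by move=> eta eta0; near=> n; exists set0; rewrite measure0 lee_fin ltW.
apply: whp_le (whp_and _ _ IH (wQ N)); near=> n => z [H HN] j.
by rewrite ltnS leq_eqVlt => /predU1P[->//|]; exact: H.
Unshelve. all: by end_near. Qed.

Section weak_law.
Variable h : measurableTypeR R -> measurableTypeR R.
Hypothesis mh : measurable_fun setT h.
Hypothesis h_ge0 : forall x, 0 <= h x.
Hypothesis h2 : (\int[gamma]_x (h x ^+ 2)%:E < +oo)%E.

Let mh2 : measurable_fun setT (fun x => (h x ^+ 2)%:E).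
Proof. by apply/measurable_EFinP; exact: measurable_funX. Qed.

Lemma square_integrable_integrable2 :
  gamma.-integrable setT (fun x => (h x ^+ 2)%:E).
Proof.
apply/integrableP; split => //.
by under eq_integral => x _ do rewrite gee0_abs ?lee_fin ?sqr_ge0//.
Qed.

Lemma square_integrable_integrable : gamma.-integrable setT (EFin \o h).
Proof.
apply: (@le_integrable _ _ _ _ _ _ _ (fun x => (1%:E + (h x ^+ 2)%:E)%E)) => //.
- exact/measurable_EFinP.
- move=> x _ /=; rewrite !lee_fin ger0_norm// ger0_norm ?addr_ge0 ?sqr_ge0//.
  have := h_ge0 x; have := sqr_ge0 (h x - 1); nra.
- apply: integrableD => //; last exact: square_integrable_integrable2.
  exact: finite_measure_integrable_cst.
Qed.

Definition normal_mean (f : R -> R) : R := fine (\int[gamma]_x (f x)%:E)%E.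

Lemma normal_meanE : (\int[gamma]_x (h x)%:E = (normal_mean h)%:E)%E.
Proof.
rewrite /normal_mean fineK//; apply: integrable_fin_num => //.
exact: square_integrable_integrable.
Qed.

(** Chebyshev's inequality. *)
Lemma weak_law (delta : R) : 0 < delta ->
  whp (fun n z => `|tuple_sum h z - n%:R * normal_mean h| <= delta * n%:R).
Proof.
move=> delta0 eta eta0; set m := normal_mean h.
pose k x := h x - m.
have mk : measurable_fun setT (k : measurableTypeR R -> measurableTypeR R).
  exact: measurable_funB.
have im : gamma.-integrable setT (cst m%:E).
  exact: finite_measure_integrable_cst.
have ik : gamma.-integrable setT (EFin \o k).
  rewrite (_ : EFin \o k = (EFin \o h) \- cst m%:E)%E//.
  by apply: integrableB => //; exact: square_integrable_integrable.
have k0 : (\int[gamma]_x (k x)%:E = 0)%E.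
  under eq_integral => x _ do rewrite /k EFinB.
  rewrite integralB//=; last exact: square_integrable_integrable.
  rewrite normal_meanE integral_cst//= [X in (_ * X)%E]probability_setT mule1.
  by rewrite subee.
have ik2 : gamma.-integrable setT (fun x => (k x ^+ 2)%:E).
  apply: (@le_integrable _ _ _ _ _ _ _
    (fun x => (2%:E * (h x ^+ 2)%:E + cst (2 * m ^+ 2)%:E x)%E)) => //.
  - by apply/measurable_EFinP; exact: measurable_funX.
  - move=> x _ /=; rewrite lee_fin.
    rewrite (ger0_norm (sqr_ge0 _)) ger0_norm; last first.
      by rewrite addr_ge0// mulr_ge0// sqr_ge0.
    rewrite /k; have := sqr_ge0 (h x + m); nra.
  - apply: integrableD => //; last exact: finite_measure_integrable_cst.
    by apply: integrableZl => //; exact: square_integrable_integrable2.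
have [v v0 vE] : exists2 v, 0 <= v & (\int[gamma]_x (k x ^+ 2)%:E = v%:E)%E.
  exists (fine (\int[gamma]_x (k x ^+ 2)%:E)).
    by apply/fine_ge0/integral_ge0 => x _; rewrite lee_fin sqr_ge0.
  by rewrite fineK//; exact: integrable_fin_num.
apply: filterS2 (nbhs_infty_gtr (0 : R)) (nbhs_infty_ger (v / (delta ^+ 2 * eta))).
move=> n n0 nv.
have kE (z : n.-tuple (measurableTypeR R)) :
    tuple_sum k z = tuple_sum h z - n%:R * m :> R.
  rewrite /tuple_sum sumrB; congr (_ - _).
  by rewrite sumr_const card_ord mulr_natl.
have mS : measurable_fun setT (fun z : n.-tuple (measurableTypeR R) =>
    ((tuple_sum k z) ^+ 2)%:E).
  apply/measurable_EFinP; apply: measurable_funX.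
  exact: measurable_tuple_sum.
pose a := (delta * n%:R) ^+ 2.
have a0 : 0 < a by rewrite exprn_gt0// mulr_gt0.
exists [set z | (a%:E <= `|(tuple_sum k z ^+ 2)%:E|)%E]; split.
- by rewrite -[X in measurable X]setTI; apply: emeasurable_fun_c_infty => //;
    exact: measurableT_comp.
- have := @le_integral_comp_abse _ _ _ (std_gauss R n) setT measurableT
    _ a id (@measurable_id _ _ _) (fun r r0 => r0) (fun x y _ _ xy => xy) mS a0.
  under eq_integral => z _ do rewrite /= ger0_norm ?sqr_ge0//.
  rewrite integral_sqr_tuple_sum// vE setTI -EFinM.
  move=> H; rewrite -(@lee_pmul2l _ a%:E)//.
  apply: le_trans H _; rewrite -EFinM lee_fin /a.
  rewrite ler_pdivrMr ?mulr_gt0 ?exprn_gt0// in nv.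
  apply: le_trans (ler_wpM2l (ltW n0) nv) _; rewrite le_eqVlt; apply/orP; left.
  by apply/eqP; ring.
- move=> z /negP; rewrite -ltNge gee0_abs ?lee_fin ?sqr_ge0// lte_fin.
  rewrite /a kE -[X in X < _]real_normK ?num_real//.
  have dn0 := ltW (mulr_gt0 delta0 n0).
  by rewrite ltr_pXn2r ?nnegrE //; exact: ltW.
Qed.

End weak_law.
End whp.

(** * Uniform control of the hinge sums *)

Section hinge.
Context {R : realType}.
Local Notation gamma := (@normal_prob R 0 1).

Definition hinge (a x : R) : R := Num.max (x - a) 0.

Lemma hinge_ge0 a x : 0 <= hinge a x.
Proof. by rewrite /hinge le_max lexx orbT. Qed.

Lemma hinge_ge a x : x - a <= hinge a x.
Proof. by rewrite /hinge le_max lexx. Qed.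

Lemma hinge_nonincreasing a b x : a <= b -> hinge b x <= hinge a x.
Proof.
move=> ab; rewrite /hinge ge_max !le_max lexx orbT andbT.
by rewrite lerD2l lerN2 ab.
Qed.

Lemma hinge_le_expR a x : 0 <= a -> hinge a x <= expR x.
Proof.
move=> a0; rewrite /hinge ge_max expR_ge0 andbT.
by apply: le_trans (expR_ge1Dx x); lra.
Qed.

(** For x > a the left-hand side is at most x^2 / 4 <= expR x by the
arithmetic-geometric inequality. The factor exp (- a) makes the contribution of
large levels a negligible uniformly in a. *)
Lemma hinge_tail a x : 0 <= a -> a * hinge a x <= expR (2 * x - a).
Proof.
move=> a0; rewrite /hinge /Num.max; case: ifPn => [_|].
  by rewrite mulr0 expR_ge0.
rewrite -leNgt subr_ge0 => ax.
apply: (@le_trans _ _ (expR x)); last by rewrite ler_expR; lra.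
have -> : expR x = expR (x / 2) ^+ 2.
  by rewrite -expRM_natl; congr expR; field.
have x20 : 0 <= x / 2 by lra.
have : (x / 2) ^+ 2 <= expR (x / 2) ^+ 2.
  by rewrite ler_pXn2r ?nnegrE ?expR_ge0//; have := expR_ge1Dx (x / 2); lra.
have := sqr_ge0 (x / 2 - a); nra.
Qed.

Lemma measurable_hinge a :
  measurable_fun setT (hinge a : measurableTypeR R -> measurableTypeR R).
Proof. by apply: measurable_maxr => //; exact: measurable_funB. Qed.

Lemma normal_mgf_lty (b : R) : (\int[gamma]_x (expR (b * x))%:E < +oo)%E.
Proof. by rewrite normal_mgf ltry. Qed.

(** The expected overshoot E (Z - a)^+ of a standard normal variable. *)
Definition excess (a : R) : R := normal_mean (hinge a).

(** The variables Z and - Z are treated together, [sg] being the sign. *)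
Section signed.
Variable sg : bool.
Local Notation e := ((-1) ^+ sg).

Let msg : measurable_fun setT (fun x : measurableTypeR R => e * x : measurableTypeR R).
Proof. exact: measurable_funM. Qed.

Let mexp (b : R) :
  measurable_fun setT (fun x : measurableTypeR R => expR (b * x) : measurableTypeR R).
Proof. by apply: measurableT_comp => //; exact: measurable_funM. Qed.

Lemma normal_mean_sign (h : measurableTypeR R -> measurableTypeR R) :
  measurable_fun setT h -> (forall x, 0 <= h x) ->
  normal_mean (fun x => h (e * x)) = normal_mean h.
Proof.
move=> mh h0; rewrite /normal_mean; congr fine.
case: sg; last first.
  by apply: eq_integral => x _; rewrite /= expr0 mul1r.
under eq_integral => x _ do rewrite /= expr1 mulN1r.
rewrite (integral_normalN (fun x => (h x)%:E))//.
exact/measurable_EFinP.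
Qed.

Let sqr_lty (h : measurableTypeR R -> measurableTypeR R) (b : R) :
  measurable_fun setT h -> (forall x, 0 <= h x <= expR (b * x)) ->
  (\int[gamma]_x (h (e * x) ^+ 2)%:E < +oo)%E.
Proof.
move=> mh hb; apply: le_lt_trans (normal_mgf_lty (2 * (b * e))).
apply: ge0_le_integral => //.
- by move=> x _; rewrite lee_fin sqr_ge0.
- apply/measurable_EFinP; apply: measurable_funX.
  exact: measurableT_comp mh msg.
- by apply/measurable_EFinP; exact: mexp.
- move=> x _; have /andP[h0 hle] := hb (e * x).
  rewrite lee_fin -mulrA expRM_natl -mulrA.
  by rewrite ler_pXn2r// nnegrE// expR_ge0.
Qed.

Lemma weak_law_sign (h : measurableTypeR R -> measurableTypeR R) (b delta : R) :
  measurable_fun setT h -> (forall x, 0 <= h x <= expR (b * x)) -> 0 < delta ->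
  whp (fun n (z : n.-tuple (measurableTypeR R)) =>
    `|tuple_sum (fun x => h (e * x)) z - n%:R * normal_mean h| <= delta * n%:R).
Proof.
move=> mh hb delta0; have h0 x : 0 <= h x by case/andP: (hb x).
rewrite -(normal_mean_sign h)//; apply: weak_law => //.
- exact: measurableT_comp mh msg.
- exact: sqr_lty hb.
Qed.

Lemma normal_mean_expR2 : normal_mean (fun x : R => expR (2 * x)) = expR 2.
Proof.
by rewrite /normal_mean normal_mgf/=; congr expR; field.
Qed.

Lemma whp_expR : whp (fun n (z : n.-tuple (measurableTypeR R)) =>
  tuple_sum (fun x => expR (2 * (e * x))) z <= (expR 2 + 1) * n%:R).
Proof.
have H := weak_law_sign (fun x => expR (2 * x)) 2 1 (mexp 2).
apply: whp_le (H _ ltr01) => [|x]; last by rewrite expR_ge0 lexx.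
apply: nearW => n z; rewrite normal_mean_expR2 => /ler_normlP[_]; lra.
Qed.

Lemma whp_hinge (a delta : R) : 0 <= a -> 0 < delta ->
  whp (fun n (z : n.-tuple (measurableTypeR R)) =>
    `|tuple_sum (fun x => hinge a (e * x)) z - n%:R * excess a| <= delta * n%:R).
Proof.
move=> a0 delta0; apply: (weak_law_sign (hinge a) 1) => //.
- exact: measurable_hinge.
- by move=> x; rewrite hinge_ge0 mul1r hinge_le_expR.
Qed.

(** Levels above A are handled by [hinge_tail]. On [0, A] the hinge sum is
nonincreasing in the level, so the weak law on a grid of step eta suffices:
moving a to the grid point below costs at most eta times the sum at level 0. *)
Lemma whp_hinge_uniform (S delta : R) :
  (forall a, 0 <= a -> a * excess a <= S) -> 0 < delta ->
  whp (fun n (z : n.-tuple (measurableTypeR R)) => forall a, 0 <= a ->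
    a * tuple_sum (fun x => hinge a (e * x)) z <= (S + delta) * n%:R).
Proof.
move=> Sub delta0.
have S0 : 0 <= S by have := Sub 0 (lexx _); rewrite mul0r.
have g0 : 0 <= excess 0.
  by apply/fine_ge0/integral_ge0 => x _; rewrite lee_fin hinge_ge0.
set C : R := expR 2 + 1; have C0 : 0 < C by rewrite addr_gt0 ?expR_gt0.
(* beyond A the exponential tail contributes less than delta *)
pose A := C / delta; have A0 : 0 < A by rewrite divr_gt0.
have CA : C * expR (- A) <= delta.
  rewrite expRN ler_pdivrMr ?expR_gt0// -ler_pdivrMl// mulrC.
  by apply: le_trans (expR_ge1Dx _); rewrite -/A lerDr.
pose eta := delta / (2 * (excess 0 + 1)).
have eta0 : 0 < eta by rewrite divr_gt0// mulr_gt0// ltr_wpDl.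
have etaE : eta * (excess 0 + 1) = delta / 2.
  by rewrite /eta; field; lra.
pose d := Num.min 1 (delta / (2 * A)).
have d0 : 0 < d by rewrite lt_min ltr01/= divr_gt0// mulr_gt0.
have d1 : d <= 1 by rewrite ge_min lexx.
have dA : A * d <= delta / 2.
  rewrite mulrC -ler_pdivlMr// ge_min; apply/orP; right.
  by rewrite le_eqVlt; apply/orP; left; apply/eqP; field; lra.
have H j := whp_hinge (j%:R * eta) d (mulr_ge0 (ler0n _ _) (ltW eta0)) d0.
apply: whp_le (whp_and _ _ whp_expR (whp_ltn _ (Num.truncn (A / eta)).+1 H)).
apply: nearW => n z [Hexp Hgrid] a a0.
have n0 : 0 <= n%:R :> R := ler0n _ _.
have [Aa|aA] := leP A a.
  rewrite tuple_sumZ.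
  apply: (@le_trans _ _ (expR (- A) * tuple_sum (fun x => expR (2 * (e * x))) z)).
    rewrite [leRHS]tuple_sumZ; apply: tuple_sum_le => x.
    apply: le_trans (hinge_tail _ _ a0) _.
    by rewrite -expRD ler_expR addrC lerD2r lerN2.
  apply: (@le_trans _ _ (expR (- A) * (C * n%:R))).
    by rewrite ler_wpM2l// expR_ge0.
  rewrite mulrA; apply: ler_wpM2r => //; rewrite mulrC.
  by apply: le_trans CA _; rewrite lerDr.
set j := Num.truncn (a / eta).
have /andP[ja aj] : (j%:R <= a / eta < j.+1%:R).
  by apply: truncn_itv; rewrite divr_ge0// ltW.
rewrite ler_pdivlMr// in ja; rewrite ltr_pdivrMr// in aj.
have jN : (j < (Num.truncn (A / eta)).+1)%N.
  by rewrite ltnS le_truncn// ler_pM2r ?invr_gt0// ltW.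
have /ler_normlP[_ Hj] := Hgrid j jN.
have /ler_normlP[_ H0] := Hgrid 0%N (ltn0Sn _).
rewrite mul0r in H0.
have := Sub (j%:R * eta) (mulr_ge0 (ler0n _ _) (ltW eta0)).
move: ja aj Hj H0; set aj := j%:R * eta.
rewrite -natr1 mulrDl mul1r -/aj.
set T := tuple_sum _ z; set T0 := tuple_sum _ z => ja aje HT HT0 Saj.
have aj0 : 0 <= aj by apply: mulr_ge0; [exact: ler0n|exact: ltW].
have T_le_T0 : T <= T0.
  by apply: tuple_sum_le => x; exact: hinge_nonincreasing.
have T_ge0 : 0 <= T by apply: tuple_sum_ge0 => x; exact: hinge_ge0.
apply: (@le_trans _ _ ((aj + eta) * T)).
  apply: (@le_trans _ _ (a * T)).
    apply: ler_wpM2l => //.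
    by apply: tuple_sum_le => x; exact: hinge_nonincreasing.
  by apply: ler_wpM2r => //; exact: ltW.
have h1 : aj * T <= (S + delta / 2) * n%:R.
  have : T <= (excess aj + d) * n%:R by lra.
  move=> /(ler_wpM2l aj0) /le_trans; apply.
  rewrite mulrA ler_wpM2r//.
  by have := ler_wpM2r (ltW d0) (le_trans ja (ltW aA)); lra.
have h2 : eta * T <= delta / 2 * n%:R.
  have : T <= (excess 0 + 1) * n%:R by have := ler_wpM2r n0 d1; lra.
  by move=> /(ler_wpM2l (ltW eta0)); rewrite mulrA etaE.
lra.
Qed.

End signed.

(** The sum of the exp (2 |z_i|) is of order n, hence so is each z_i ^+ 4: this
bounds the coordinates by a multiple of n^(1/4), far below the scale sqrt n. *)
Lemma whp_coordinates (eps : R) : 0 < eps ->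
  whp (fun n (z : n.-tuple (measurableTypeR R)) =>
    forall i, `|tnth z i| <= eps * Num.sqrt n%:R).
Proof.
move=> eps0.
set C : R := expR 2 + 1; have C0 : 0 < C by rewrite addr_gt0 ?expR_gt0.
apply: whp_le (whp_and _ _ (whp_expR false) (whp_expR true)).
apply: filterS2 (nbhs_infty_gtr (0 : R)) (nbhs_infty_ger (16 * C / eps ^+ 4)).
move=> n n0; rewrite ler_pdivrMr ?exprn_gt0// => nC z [Hp Hm] i.
have [sg zE] : exists sg : bool, `|tnth z i| = (-1) ^+ sg * tnth z i.
  have [z0|z0] := leP 0 (tnth z i).
    by exists false; rewrite ger0_norm//= expr0 mul1r.
  by exists true; rewrite ltr0_norm//= expr1 mulN1r.
have H : tuple_sum (fun x => expR (2 * ((-1) ^+ sg * x))) z <= C * n%:R.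
  by case: sg {zE}.
have {}H : expR (2 * `|tnth z i|) <= C * n%:R.
  apply: le_trans H; rewrite zE /tuple_sum (bigD1 i)//= lerDl.
  by apply: sumr_ge0 => k _; rewrite expR_ge0.
set x := `|tnth z i| in H *.
have x0 : 0 <= x := normr_ge0 _.
have x4 : x ^+ 4 <= 16 * expR (2 * x).
  have -> : 2 * x = 4 * (x / 2) by field.
  rewrite expRM_natl; have -> : 16 = 2 ^+ 4 :> R by ring.
  rewrite -exprMn ler_pXn2r ?nnegrE// ?mulr_ge0 ?expR_ge0//.
  by have := expR_ge1Dx (x / 2); lra.
rewrite -(@ler_pXn2r _ 4)// ?nnegrE ?mulr_ge0 ?sqrtr_ge0 ?(ltW eps0)//.
rewrite exprMn (_ : 4 = 2 * 2)%N// [X in _ * X]exprM sqr_sqrtr ?ler0n//.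
rewrite -[(2 * 2)%N]/4%N.
nra.
Qed.

End hinge.

(** * The statistic for the design with orthogonal predictors *)

Section design.
Context {R : realType}.

Lemma column_orth_design m (c : R) (k i : 'I_m.+1) :
  column (orth_design m c) k 0 i =
  if k == ord_max then
    if i == ord_max then Num.sqrt (1 - m%:R * c ^+ 2) else c
  else (i == k)%:R.
Proof. by rewrite /column /orth_design !mxE. Qed.

(** Orthogonality to the canonical vectors of M kills these coordinates, while
subtracting a combination of them leaves all the others unchanged. *)
Lemma residual_orth_designE m (c : R) (M : {set 'I_m.+1}) (i : 'I_m.+1) :
  residual (orth_design m c) ord_max M 0 i =
  if i \in (M :\ ord_max)%SET then 0
  else column (orth_design m c) ord_max 0 i.
Proof.
set X := orth_design m c; case: ifPn => iM.
  have := @residual_orth R m.+1 X ord_max M i iM.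
  rewrite /dot (bigD1 i)//= column_orth_design.
  have iN : i != ord_max by move: iM; rewrite !inE => /andP[].
  rewrite (negbTE iN) eqxx mulr1 big1 ?addr0// => j ji.
  by rewrite column_orth_design (negbTE iN) (negbTE ji) mulr0.
have sub : (span_columns X (M :\ ord_max)%SET <= kermx (delta_mx i 0 : 'cV[R]_m.+1))%MS.
  apply/sumsmx_subP => k kM; rewrite genmxE; apply/sub_kermxP/matrixP => u v.
  rewrite !ord1 !mxE big1// => j _; rewrite [delta_mx _ _ _ _]mxE.
  have [ji|] := eqVneq j i; last by rewrite mulr0.
  rewrite ji column_orth_design; move: (kM); rewrite !inE => /andP[kN _].
  rewrite (negbTE kN) (_ : (i == k) = false) ?mul0r//.
  by apply: contraNF iM => /eqP ->.
have subE (u v : 'rV[R]_m.+1) : (u - v) 0 i = u 0 i - v 0 i by rewrite !mxE.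
have /sub_kermxP := submx_trans (residual_sub X ord_max M) sub.
move=> /matrixP/(_ 0 0); rewrite -colE [LHS]mxE [RHS]mxE subE => /eqP.
by rewrite subr_eq0 => /eqP.
Qed.

(** Stated for a general f to give both the inner product with z and the squared
norm of the residual. *)
Lemma sum_residual_orth_design m (c : R) (M : {set 'I_m.+1}) (f : R -> 'I_m.+1 -> R) :
  ord_max \in M -> (forall i, f 0 i = 0) ->
  \sum_i f (residual (orth_design m c) ord_max M 0 i) i =
  f (Num.sqrt (1 - m%:R * c ^+ 2)) ord_max + \sum_(i in ~: M) f c i.
Proof.
move=> pM f0; rewrite (bigD1 ord_max)//=; congr (_ + _).
  by rewrite residual_orth_designE !inE eqxx/= column_orth_design !eqxx.
rewrite (bigID (mem M))/= big1 ?add0r => [|i /andP[iN iM]]; last first.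
  by rewrite residual_orth_designE !inE iN iM f0.
apply: eq_big => [i|i /andP[iN iM]].
  rewrite !inE; case: eqVneq => [->|//]; by rewrite pM.
rewrite residual_orth_designE !inE (negbTE iM) andbF column_orth_design.
by rewrite eqxx (negbTE iN).
Qed.

Lemma dot_unit_residual m (c : R) (M : {set 'I_m.+1}) (z : 'rV[R]_m.+1) :
  ord_max \in M -> m%:R * c ^+ 2 <= 1 ->
  let s := Num.sqrt (1 - m%:R * c ^+ 2) in
  dot (unit_residual (orth_design m c) ord_max M) z =
  (s * z 0 ord_max + c * \sum_(i in ~: M) z 0 i) /
    Num.sqrt (s ^+ 2 + c ^+ 2 * #|~: M|%:R).
Proof.
move=> pM mc s; rewrite mulrC /unit_residual /norm2 /dot.
under eq_bigr => i _ do rewrite mxE -mulrA.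
rewrite -mulr_sumr (sum_residual_orth_design _ _ _ (fun x i => x * z 0 i))//; last first.
  by move=> i; rewrite mul0r.
rewrite (sum_residual_orth_design _ _ _ (fun x _ => x * x))//; last first.
  by move=> i; rewrite mul0r.
rewrite -/s (_ : \sum_(i in ~: M) c * z 0 i =
   c * \sum_(i in ~: M) z 0 i) ?mulr_sumr//.
congr ((Num.sqrt _)^-1 * _).
by rewrite sumr_const mulr_natr !expr2.
Qed.

(** The easy half of the duality, applied at the optimal level: for
a = S / (2 |U|) the bound a (S - a |U|) <= B reads S^2 <= 4 B |U|. *)
Lemma subset_sum_le n (z : n.-tuple (measurableTypeR R)) (U : {set 'I_n}) (e B : R) :
  0 <= B ->
  (forall a, 0 <= a -> a * tuple_sum (fun x => hinge a (e * x)) z <= B) ->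
  e * \sum_(i in U) tnth z i <= 2 * Num.sqrt B * Num.sqrt #|U|%:R.
Proof.
move=> B0 HB; set S := e * _.
have [S0|S0] := leP S 0; first by rewrite (le_trans S0)// !mulr_ge0 ?sqrtr_ge0.
have k0 : 0 < #|U|%:R :> R.
  rewrite ltr0n lt0n; apply/eqP => /cards0_eq U0.
  by move: S0; rewrite /S U0 big_set0 mulr0 ltxx.
set k := #|U|%:R in k0 *; set a := S / (2 * k).
have a0 : 0 <= a by apply: divr_ge0; [exact: ltW|exact: mulr_ge0 (ler0n _ 2) (ltW k0)].
have H : S - a * k <= tuple_sum (fun x => hinge a (e * x)) z.
  rewrite /S mulr_sumr mulr_natr -sumr_const -sumrB /tuple_sum big_mkcond/=.
  apply: ler_sum => i _; case: ifP => _; last exact: hinge_ge0.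
  exact: hinge_ge.
have := le_trans (ler_wpM2l a0 H) (HB a a0).
have -> : a * (S - a * k) = S ^+ 2 / (4 * k).
  by rewrite /a; field; rewrite gt_eqF.
rewrite ler_pdivrMr ?mulr_gt0// => HS.
have bE : (2 * Num.sqrt B * Num.sqrt k) ^+ 2 = B * (4 * k).
  by rewrite !exprMn !sqr_sqrtr ?(ltW k0)//; ring.
by rewrite -(@ler_pXn2r _ 2) ?nnegrE ?(ltW S0) ?bE// !mulr_ge0 ?sqrtr_ge0.
Qed.

(** Uniformity in c: both |c| sqrt |U| and the last coordinate of the predictor
are bounded by the norm of the residual. *)
Lemma max_stat_le m (c : R) (z : m.+1.-tuple (measurableTypeR R)) (B t : R) :
  m%:R * c ^+ 2 < 1 -> 0 <= B ->
  (forall (sg : bool) a, 0 <= a ->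
    a * tuple_sum (fun x => hinge a ((-1) ^+ sg * x)) z <= B) ->
  `|tnth z ord_max| <= t ->
  max_stat (orth_design m c) ord_max z <= 2 * Num.sqrt B + t.
Proof.
move=> mc B0 HB zt; have t0 : 0 <= t := le_trans (normr_ge0 _) zt.
have b0 : 0 <= 2 * Num.sqrt B by rewrite mulr_ge0 ?sqrtr_ge0.
apply: bigmax_le => [|M pM]; first exact: addr_ge0.
rewrite dot_unit_residual//; last exact: ltW.
set s := Num.sqrt _; set k := #|_|%:R.
have s0 : 0 < s by rewrite sqrtr_gt0 subr_gt0.
have k0 : 0 <= k :> R := ler0n _ _.
set N := Num.sqrt (s ^+ 2 + _).
have ck0 : 0 <= c ^+ 2 * k by rewrite mulr_ge0 ?sqr_ge0.
have sN : s <= N.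
  by rewrite -[s]ger0_norm ?(ltW s0)// -sqrtr_sqr; apply: ler_wsqrtr; rewrite lerDl.
have cN : `|c| * Num.sqrt k <= N.
  rewrite -sqrtr_sqr -sqrtrM ?sqr_ge0//; apply: ler_wsqrtr.
  by rewrite lerDr sqr_ge0.
have N0 : 0 < N := lt_le_trans s0 sN.
rewrite normrM normfV (gtr0_norm N0) ler_pdivrMr// mxE.
apply: le_trans (ler_normD _ _) _; rewrite !normrM (gtr0_norm s0).
have -> : \sum_(i in ~: M) (\row_i tnth z i) 0 i = \sum_(i in ~: M) tnth z i.
  by apply: eq_bigr => i _; rewrite mxE.
have HU : `|\sum_(i in ~: M) tnth z i| <= 2 * Num.sqrt B * Num.sqrt k.
  have Hp := subset_sum_le _ z (~: M) _ B B0 (HB false).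
  have Hm := subset_sum_le _ z (~: M) _ B B0 (HB true).
  rewrite ler_norml; apply/andP; split.
    by move: Hm; rewrite expr1 mulN1r lerNl.
  by move: Hp; rewrite expr0 mul1r.
rewrite mulrDl addrC; apply: lerD.
  apply: le_trans (ler_wpM2l (normr_ge0 c) HU) _.
  by rewrite mulrCA ler_wpM2l.
by rewrite mulrC; apply: ler_pM => //; exact: ltW.
Qed.

(** The other half of the duality. With c = 1 / sqrt p all the coordinates of
X_p(c) are equal, so the direction obtained by keeping the coordinates above the
level a, together with the last one, is a normalized indicator. *)
Lemma max_stat_ge m (z : m.+1.-tuple (measurableTypeR R)) (K a : R) :
  0 < a ->
  max_stat (orth_design m (Num.sqrt m.+1%:R)^-1) ord_max z <= K ->
  a * tuple_sum (hinge a) z <= K ^+ 2 / 4 + a ^+ 2 + a * `|tnth z ord_max|.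
Proof.
move=> a0 HK; set c := (Num.sqrt m.+1%:R)^-1 in HK *.
have c0 : 0 < c :> R by rewrite invr_gt0 sqrtr_gt0 ltr0n.
have c2 : c ^+ 2 = m.+1%:R^-1 :> R by rewrite exprVn sqr_sqrtr ?ler0n.
have sc : Num.sqrt (1 - m%:R * c ^+ 2) = c :> R.
  have -> : 1 - m%:R * c ^+ 2 = c ^+ 2 :> R.
    by rewrite c2 -natr1; field; rewrite natr1 pnatr_eq0.
  by rewrite sqrtr_sqr gtr0_norm.
pose M := [set i | (i == ord_max) || (tnth z i <= a)]%SET.
have pM : ord_max \in M by rewrite inE eqxx.
have mc1 : m%:R * c ^+ 2 <= 1 :> R.
  by rewrite c2 ler_pdivrMr ?ltr0n// mul1r ler_nat.
have := le_trans (le_bigmax_cond _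
  (fun M => `|dot (unit_residual (orth_design m c) ord_max M)
    (\row_i tnth z i)|) pM) HK.
rewrite dot_unit_residual// sc mxE.
have -> : \sum_(i in ~: M) (\row_i tnth z i) 0 i = \sum_(i in ~: M) tnth z i.
  by apply: eq_bigr => i _; rewrite mxE.
set k := #|_|%:R; set S := \sum_(i in _) _; set zp := tnth z ord_max.
have k0 : 0 <= k :> R := ler0n _ _.
have -> : Num.sqrt (c ^+ 2 + c ^+ 2 * k) = c * Num.sqrt (1 + k).
  by rewrite -{1}[c ^+ 2]mulr1 -mulrDr sqrtrM ?sqr_ge0// sqrtr_sqr gtr0_norm.
rewrite -mulrDr -mulf_div divff ?gt_eqF// mul1r => /(le_trans (ler_norm _)).
have q0 : 0 < Num.sqrt (1 + k) :> R by rewrite sqrtr_gt0 ltr_wpDr.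
rewrite ler_pdivrMr// => HS.
have TE : tuple_sum (hinge a) z = hinge a zp + (S - a * k).
  rewrite /tuple_sum (bigD1 ord_max)//=; congr (_ + _).
  rewrite (bigID (fun i => tnth z i <= a))/= big1 ?add0r; last first.
    by move=> i /andP[_ zi]; rewrite /hinge max_r// subr_le0.
  rewrite mulr_natr -sumr_const -sumrB; apply: eq_big => [i|i /andP[_ zi]].
    by rewrite !inE negb_or.
  by rewrite /hinge max_l// subr_ge0 ltW// ltNge.
have hz : hinge a zp <= `|zp| + zp.
  rewrite /hinge ge_max; have := ler_norm zp; have := ler_norm (- zp).
  by rewrite normrN => *; apply/andP; split; lra.
set q := Num.sqrt (1 + k) in q0 HS.
have qE : q ^+ 2 = 1 + k by rewrite sqr_sqrtr// addr_ge0.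
rewrite TE; have := sqr_ge0 (K / 2 - a * q).
have := ler_wpM2l (ltW a0) HS; have := ler_wpM2l (ltW a0) hz.
have := congr1 (fun x => a ^+ 2 * x) qE; nra.
Qed.

End design.

(** * Taylor enclosures and bounds on pi *)

Section taylor.
Context {R : realType}.

(** The engine of the Taylor bounds: the remainder of order n has the remainder
of order n - 1 as derivative, up to sign, so signs propagate by induction. *)
Lemma ge0_of_derive_ge0 (f df : R -> R) :
  (forall x : R, is_derive x (1 : R) f (df x)) -> f 0 = 0 ->
  (forall x, 0 <= x -> 0 <= df x) -> forall x, 0 <= x -> 0 <= f x.
Proof.
move=> fdf f0 df0 x x0.
have cf : {within `[0, x], continuous f}.
  by apply: derivable_within_continuous => y _; have [] := fdf y.
have [y] := MVT_segment x0 (fun y _ => fdf y) cf.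
rewrite in_itv/= f0 !subr0 => /andP[y0 _] ->.
by rewrite mulr_ge0 ?df0.
Qed.

Lemma is_derive_horner (p : {poly R}) (x : R) :
  is_derive x (1 : R) (horner p) p^`().[x].
Proof.
by apply: DeriveDef; [exact: derivable_horner|rewrite -derive1E derivE].
Qed.

(** Inverse factorials as iterated quotients, so that concrete Taylor polynomials
reduce to small numerals. *)
Fixpoint inv_fact n : R := if n is m.+1 then inv_fact m / n%:R else 1.

Definition expN_poly n : {poly R} := \poly_(i < n) ((-1) ^+ i * inv_fact i).
Definition cos_poly n : {poly R} :=
  \poly_(i < n) ((~~ odd i)%:R * (-1) ^+ i./2 * inv_fact i).
Definition sin_poly n : {poly R} :=
  \poly_(i < n) ((odd i)%:R * (-1) ^+ i./2 * inv_fact i).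

Let inv_factS (x : R) i : x * inv_fact i.+1 *+ i.+1 = x * inv_fact i.
Proof. by rewrite /= -mulr_natr mulrA divfK// pnatr_eq0. Qed.

Lemma deriv_expN_poly n : (expN_poly n.+1)^`() = - expN_poly n.
Proof.
apply/polyP => i; rewrite coef_deriv coefN !coef_poly ltnS.
case: ifP => _; last by rewrite mul0rn oppr0.
by rewrite inv_factS exprS mulN1r mulNr.
Qed.

Lemma deriv_cos_poly n : (cos_poly n.+1)^`() = - sin_poly n.
Proof.
apply/polyP => i; rewrite coef_deriv coefN !coef_poly ltnS.
case: ifP => _; last by rewrite mul0rn oppr0.
rewrite inv_factS oddS negbK [i.+1./2]/= uphalf_half -mulNr; congr (_ * _).
by case: (odd i); rewrite ?mul0r ?oppr0// !mul1r exprS mulN1r.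
Qed.

Lemma deriv_sin_poly n : (sin_poly n.+1)^`() = cos_poly n.
Proof.
apply/polyP => i; rewrite coef_deriv !coef_poly ltnS.
case: ifP => _; last by rewrite mul0rn.
rewrite inv_factS oddS [i.+1./2]/= uphalf_half; congr (_ * _).
by case: (odd i); rewrite ?mul0r.
Qed.

Lemma expN_taylor n (x : R) : 0 <= x ->
  0 <= (-1) ^+ n * (expR (- x) - (expN_poly n).[x]).
Proof.
elim: n x => [|n IH] x x0.
  by rewrite expr0 mul1r /expN_poly horner_poly big_ord0 subr0 expR_ge0.
move: x x0; apply: (@ge0_of_derive_ge0 _
    (fun x => (-1) ^+ n * (expR (- x) - (expN_poly n).[x]))) => [x||].
- have dp := is_derive_horner (expN_poly n.+1) x.
  have dN : is_derive x (1 : R) (fun y : R => expR (- y)) (- expR (- x)).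
    by apply: is_derive_eq; rewrite mulrN1.
  apply: is_derive_eq.
  rewrite deriv_expN_poly hornerN exprS mulN1r /GRing.scale/=; ring.
- by rewrite oppr0 expR0 horner_coef0 coef_poly/= expr0 mulr1 subrr mulr0.
- exact: IH.
Qed.

(** Each step goes through the sine polynomial of intermediate degree. *)
Lemma cos_taylor n (x : R) : 0 <= x ->
  0 <= (-1) ^+ n.+1 * (cos x - (cos_poly n.*2.+1).[x]).
Proof.
elim: n x => [|n IH] x x0.
  rewrite expr1 mulN1r opprB subr_ge0 /cos_poly horner_poly big_ord1/=.
  by rewrite !expr0 !mul1r ?mulr1 cos_le1.
have sin_step y : 0 <= y -> 0 <= (-1) ^+ n.+1 * (sin y - (sin_poly n.*2.+2).[y]).
  move: y; apply: (@ge0_of_derive_ge0 _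
    (fun x => (-1) ^+ n.+1 * (cos x - (cos_poly n.*2.+1).[x]))) => [y||].
  - have dp := is_derive_horner (sin_poly n.*2.+2) y.
    by apply: is_derive_eq; rewrite deriv_sin_poly.
  - by rewrite sin0 horner_coef0 coef_poly/= !mul0r subrr mulr0.
  - exact: IH.
move: x x0; apply: (@ge0_of_derive_ge0 _
    (fun x => (-1) ^+ n.+1 * (sin x - (sin_poly n.*2.+2).[x]))) => [y||].
- have dp := is_derive_horner (cos_poly n.*2.+3) y.
  apply: is_derive_eq; rewrite deriv_cos_poly hornerN exprS mulN1r /GRing.scale/=.
  ring.
- by rewrite cos0 horner_coef0 coef_poly/= !expr0 !mul1r subrr mulr0.
- exact: sin_step.
Qed.

(** Cosine is decreasing on [0, pi] and vanishes at pi / 2; it is positive at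
1.57075 and negative at 1.57085. *)
Lemma pi_bounds : 3 + 1415 / 10 ^+ 4 <= (pi : R) <= 3 + 1417 / 10 ^+ 4.
Proof.
have pi2 := @pi_ge2 R.
have p2 : pi / 2 \in `[0, (pi : R)] by rewrite in_itv/=; apply/andP; split; lra.
have cos_ge (x : R) : 0 <= x -> 1 - x ^+ 2 / 2 * (1 - x ^+ 2 / (3 * 4) *
    (1 - x ^+ 2 / (5 * 6) * (1 - x ^+ 2 / (7 * 8) * (1 - x ^+ 2 / (9 * 10))))) <= cos x.
  move=> /(cos_taylor 5); rewrite /cos_poly (_ : 5.*2.+1 = 11)%N//.
  by rewrite horner_poly !big_ord_recr big_ord0 /=; lra.
have cos_le (x : R) : 0 <= x -> cos x <= 1 - x ^+ 2 / 2 * (1 - x ^+ 2 / (3 * 4) *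
    (1 - x ^+ 2 / (5 * 6) * (1 - x ^+ 2 / (7 * 8)))).
  move=> /(cos_taylor 4); rewrite /cos_poly (_ : 4.*2.+1 = 9)%N//.
  by rewrite horner_poly !big_ord_recr big_ord0 /=; lra.
apply/andP; split.
  pose x : R := 1 + 57 / 10 ^+ 2 + 75 / 10 ^+ 5.
  have x0 : 0 <= x by rewrite /x; lra.
  have : 0 < cos x by apply: lt_le_trans (cos_ge x x0); rewrite /x; lra.
  rewrite -(@cos_pihalf R) ltr_cos// /x; first lra.
  by rewrite in_itv/=; apply/andP; split; lra.
have [//|] := leP pi (3 + 1417 / 10 ^+ 4 : R) => pi_gt.
pose x : R := 1 + 57 / 10 ^+ 2 + 85 / 10 ^+ 5.
have x0 : 0 <= x by rewrite /x; lra.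
have : cos x < 0 by apply: le_lt_trans (cos_le x x0) _; rewrite /x; lra.
rewrite -(@cos_pihalf R) ltr_cos// /x; first lra.
by rewrite in_itv/=; apply/andP; split; lra.
Qed.

End taylor.

(** * A formula for the expected hinge *)

Section excess.
Context {R : realType}.
Local Notation mu := (@lebesgue_measure R).
Local Notation gamma := (@normal_prob R 0 1).
Local Notation phi := (@normal_pdf R 0 1).
Local Notation c := (@normal_peak R 1).

Lemma normal_pdf01E (x : R) : phi x = c * expR (- (x ^+ 2 / 2)).
Proof.
by rewrite normal_pdfE ?oner_neq0// /normal_fun subr0 expr1n mulNr.
Qed.

Lemma normal_pdf01N (x : R) : phi (- x) = phi x.
Proof. by rewrite !normal_pdf01E sqrrN. Qed.

Lemma is_derive_normal_pdf (x : R) : is_derive x (1 : R) phi (- x * phi x).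
Proof.
rewrite [X in is_derive _ _ X](_ : phi = fun x => c * expR (- (x ^+ 2 / 2))); last first.
  by apply/funext => y; rewrite normal_pdf01E.
rewrite normal_pdf01E.
have d : is_derive x (1 : R) (fun y : R => - (y ^+ 2 / 2)) (- x).
  by apply: is_derive_eq; rewrite /GRing.scale/=; field.
have d' : is_derive x (1 : R) (fun y : R => expR (- (y ^+ 2 / 2)))
    (expR (- (x ^+ 2 / 2)) * - x).
  exact: (@is_derive1_comp _ expR (fun y : R => - (y ^+ 2 / 2))).
by apply: is_derive_eq; rewrite /GRing.scale/=; ring.
Qed.

Lemma cvg_normal_pdf : phi x @[x --> +oo%R] --> (0 : R).
Proof.
rewrite (_ : phi = fun x => c * expR (- (x ^+ 2 / 2))); last first.
  by apply/funext => y; rewrite normal_pdf01E.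
rewrite -[X in _ --> X](mulr0 c); apply: cvgM; first exact: cvg_cst.
apply: (cvg_comp (fun x : R => x ^+ 2 / 2) (fun x => expR (- x))).
  apply: gt0_cvgMly => //; exact: cvgr_expr2.
exact: cvgr_expR.
Qed.

Lemma measurable_EFin_normal_pdf :
  measurable_fun setT (fun x : measurableTypeR R => (phi x)%:E).
Proof. by apply/measurable_EFinP; exact: measurable_normal_pdf. Qed.

Lemma integral_x_normal_pdf :
  (\int[mu]_(x in `[0%R, +oo[) (x * phi x)%:E = c%:E)%E.
Proof.
have c0 : - phi 0 = - c :> R by rewrite normal_pdf01E expr0n mul0r oppr0 expR0 mulr1.
rewrite (@ge0_continuous_FTC2y _ _ (fun x => - phi x) _ 0).
- by rewrite c0 sub0e EFinN oppeK.
- by move=> x x0; rewrite mulr_ge0 ?normal_pdf_ge0.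
- apply: continuous_subspaceT => x; apply: cvgM => //.
  exact: continuous_normal_pdf (oner_neq0 _) _.
- by rewrite -[X in _ --> X]oppr0; apply: cvgN; exact: cvg_normal_pdf.
- by move=> x _; have := is_derive_normal_pdf x => *; exact: derivableN.
- apply: cvg_at_right_filter; apply: cvgN.
  exact: continuous_normal_pdf (oner_neq0 _) _.
- move=> x _; rewrite derive1E; have := is_derive_normal_pdf x => d.
  by rewrite derive_val; ring.
Qed.

Lemma integral_half_normal_pdf :
  (\int[mu]_(x in `[0%R, +oo[) (phi x)%:E = (1 / 2)%:E)%E.
Proof.
have m (D : set (measurableTypeR R)) :
    measurable_fun D (fun x : measurableTypeR R => (phi x)%:E).
  exact: measurable_funTS measurable_EFin_normal_pdf.
have phi0 x : (0 <= (phi x)%:E)%E by rewrite lee_fin normal_pdf_ge0.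
set H := (\int[mu]_(x in _) _)%E.
have HE : H = (\int[mu]_(x in `]-oo, 0%R]) (phi x)%:E)%E.
  rewrite /H ge0_integration_by_substitution0//; last exact: measurable_EFin_normal_pdf.
  by apply: eq_integral => x _; rewrite normal_pdf01N.
have HE' : H = (\int[mu]_(x in `]0%R, +oo[) (phi x)%:E)%E.
  by rewrite integral_itv_obnd_cbnd; [|exact: m].
have : (H + H = 1)%E.
  rewrite -(@integral_normal_pdf R 0 1) {1}HE HE' -ge0_integral_setU//=.
  - by congr (integral _ _ _); rewrite itv_setU_setT.
  - by apply/disj_setPS => x /=; rewrite !in_itv/= andbT => -[x0 /lt_geF]; rewrite x0.
case: H {HE HE'} => [h| |]//=.
by rewrite -EFinD => -[hh]; congr EFin; lra.
Qed.


Lemma integral_excess (a : R) : 0 <= a ->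
  (\int[gamma]_x (hinge a x)%:E = (excess a)%:E)%E.
Proof.
move=> a0; rewrite /excess /normal_mean fineK// ge0_fin_numE; last first.
  by apply: integral_ge0 => x _; rewrite lee_fin hinge_ge0.
apply: le_lt_trans (normal_mgf_lty 1); apply: ge0_le_integral => //.
- by move=> x _; rewrite lee_fin hinge_ge0.
- by apply/measurable_EFinP; exact: measurable_hinge.
- by apply/measurable_EFinP; apply: measurableT_comp => //; exact: measurable_funM.
- by move=> x _; rewrite lee_fin mul1r hinge_le_expR.
Qed.

Lemma excess_ge0 (a : R) : 0 <= excess a.
Proof. by apply/fine_ge0/integral_ge0 => x _; rewrite lee_fin hinge_ge0. Qed.

(** On the half-line x >= 0 one has (x - a)^+ + a = x + (a - x)^+, and both
members are nonnegative; P (Z >= 0) = 1 / 2 and E Z^+ is the peak of the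
density. *)
Lemma excess_split (a : R) : 0 <= a ->
  (excess a + a / 2)%:E =
  (c%:E + \int[mu]_(x in `[0%R, a]) ((a - x) * phi x)%:E)%E.
Proof.
move=> a0; have phi0 x : 0 <= phi x by exact: normal_pdf_ge0.
have mh : measurable_fun setT (fun x : measurableTypeR R => (hinge a x)%:E).
  by apply/measurable_EFinP; exact: measurable_hinge.
have mphiM (g : measurableTypeR R -> measurableTypeR R) : measurable_fun setT g ->
    measurable_fun setT (fun x : measurableTypeR R => (g x * phi x)%:E).
  move=> mg; apply/measurable_EFinP; apply: measurable_funM => //.
  exact: measurable_normal_pdf.
have mx : measurable_fun setT (fun x : measurableTypeR R => (x * phi x)%:E).
  exact: mphiM.
have maxphi : measurable_fun setT (fun x : measurableTypeR R => ((a - x) * phi x)%:E).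
  by apply: mphiM; exact: measurable_funB.
have ma : measurable_fun setT (fun x : measurableTypeR R => (a * phi x)%:E).
  exact: mphiM.
rewrite EFinD -integral_excess// integral_normal_prob//; last first.
  by move=> x; rewrite lee_fin hinge_ge0.
have -> : (a / 2)%:E = (\int[mu]_(x in `[0%R, +oo[) (a * phi x)%:E)%E.
  under eq_integral => x _ do rewrite EFinM.
  rewrite ge0_integralZl//.
  - by rewrite integral_half_normal_pdf -EFinM mul1r.
  - exact: measurable_funTS measurable_EFin_normal_pdf.
  - by move=> x _; rewrite lee_fin.
rewrite -integral_x_normal_pdf.
rewrite [X in (_ + X = _)%E]integral_mkcond/= [X in (_ = X + _)%E]integral_mkcond/=.
rewrite [X in (_ = _ + X)%E]integral_mkcond/=.
rewrite -!ge0_integralD//=.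
- apply: eq_integral => x _; rewrite !patchE !mem_setE !in_itv/= andbT.
  rewrite /hinge; have [x0|x0] /= := leP 0 x; last first.
    by rewrite max_r ?mul0e ?add0e//; lra.
  have [xa|xa] := leP x a.
    by rewrite max_r ?mul0e ?add0e -?EFinD -?mulrDl ?subr_le0//; congr (_ * _)%:E; ring.
  by rewrite max_l ?subr_ge0 ?ltW// -EFinM adde0 -EFinD -mulrDl subrK.
all: try (by move=> x _; rewrite mule_ge0// lee_fin ?hinge_ge0).
all: try (by move=> x _; apply: erestrict_ge0 => y /=; rewrite in_itv/= => /andP[y0 ya];
  rewrite lee_fin mulr_ge0// ?subr_ge0).
all: try by apply/(measurable_restrictT _ _).1 => //; exact: measurable_funTS.
all: try by apply: emeasurable_funM => //; exact: measurable_EFin_normal_pdf.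
all: try by move=> x _; apply: erestrict_ge0 => y /=; rewrite in_itv/= andbT => y0;
  rewrite lee_fin mulr_ge0.
Qed.

Lemma integral_0a_derive (f F : R -> R) (a : R) : 0 < a ->
  (forall x : R, is_derive x (1 : R) F (f x)) ->
  (forall x : R, derivable f x (1 : R)) ->
  (\int[mu]_(x in `[0%R, a]) (f x)%:E = (F a - F 0)%:E)%E.
Proof.
move=> a0 dF df.
have cF x : {for x, continuous F}.
  by apply/differentiable_continuous/derivable1_diffP; have [] := dF x.
rewrite (@continuous_FTC2 _ _ F)// ?EFinB//.
- by apply: derivable_within_continuous => x _.
- split => [x _| |]; first by have [] := dF x.
  + by apply: cvg_at_right_filter; exact: cF.
  + by apply: cvg_at_left_filter; exact: cF.
- by move=> x _; rewrite derive1E; have dFx := dF x; rewrite derive_val.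
Qed.

Lemma derivable_measurable (f : measurableTypeR R -> measurableTypeR R) :
  (forall x : R, derivable f x (1 : R)) -> measurable_fun setT f.
Proof.
move=> df; apply: continuous_measurable_fun => x.
exact/differentiable_continuous/derivable1_diffP.
Qed.

(** Integrating (a - x) against the Taylor polynomial of degree 2 in x^2 / 2,
which is above the exponential; the polynomial of degree 3, below it, is used
in [excess_ge]. *)
Lemma excess_le (a : R) : 0 < a ->
  excess a + a / 2 <= c * (1 + a ^+ 2 / 2 - a ^+ 4 / 24 + a ^+ 6 / 240).
Proof.
move=> a0.
pose p (x : R) : R := 1 - x ^+ 2 / 2 + x ^+ 4 / 8.
pose F (x : R) : R := c * (a * x - x ^+ 2 / 2 - a * x ^+ 3 / 6 + x ^+ 4 / 8
   + a * x ^+ 5 / 40 - x ^+ 6 / 48).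
have df (x : R) : derivable (fun x => c * ((a - x) * p x)) x (1 : R).
  by rewrite /p; apply/ex_derive.
have FE : (\int[mu]_(x in `[0%R, a]) (c * ((a - x) * p x))%:E = (F a - F 0)%:E)%E.
  apply: integral_0a_derive => // x; rewrite /F /p.
  by apply: is_derive_eq; rewrite /GRing.scale/=; field.
have pexp (x : R) : expR (- (x ^+ 2 / 2)) <= p x.
  have /(expN_taylor 3) : 0 <= x ^+ 2 / 2 by have := sqr_ge0 x; lra.
  by rewrite /expN_poly horner_poly !big_ord_recr big_ord0 /= /p; lra.
rewrite -lee_fin excess_split ?(ltW a0)//.
apply: (@le_trans _ _ (c%:E + (F a - F 0)%:E)%E); last first.
  by rewrite -EFinD lee_fin /F le_eqVlt; apply/orP; left; apply/eqP; field.
rewrite -FE leeD2l//; apply: ge0_le_integral => //.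
- by move=> x /=; rewrite in_itv/= => /andP[x0 xa];
    rewrite lee_fin mulr_ge0 ?subr_ge0 ?normal_pdf_ge0.
- apply/measurable_EFinP/measurable_funTS; apply: measurable_funM.
    exact: measurable_funB.
  exact: measurable_normal_pdf.
- by apply/measurable_EFinP/measurable_funTS; exact: derivable_measurable.
- move=> x /=; rewrite in_itv/= => /andP[x0 xa]; rewrite lee_fin normal_pdf01E.
  by rewrite mulrCA ler_wpM2l ?normal_peak_ge0// ler_wpM2l ?subr_ge0.
Qed.

Lemma excess_ge (a : R) : 0 < a ->
  c * (1 + a ^+ 2 / 2 - a ^+ 4 / 24 + a ^+ 6 / 240 - a ^+ 8 / (48 * 56)) <=
  excess a + a / 2.
Proof.
move=> a0.
pose p (x : R) : R := 1 - x ^+ 2 / 2 + x ^+ 4 / 8 - x ^+ 6 / 48.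
pose F (x : R) : R := c * (a * x - x ^+ 2 / 2 - a * x ^+ 3 / 6 + x ^+ 4 / 8
   + a * x ^+ 5 / 40 - x ^+ 6 / 48 - a * x ^+ 7 / (48 * 7) + x ^+ 8 / (48 * 8)).
have df (x : R) : derivable (fun x => c * ((a - x) * p x)) x (1 : R).
  by rewrite /p; apply/ex_derive.
have FE : (\int[mu]_(x in `[0%R, a]) (c * ((a - x) * p x))%:E = (F a - F 0)%:E)%E.
  apply: integral_0a_derive => // x; rewrite /F /p.
  by apply: is_derive_eq; rewrite /GRing.scale/=; field.
have pexp (x : R) : p x <= expR (- (x ^+ 2 / 2)).
  have /(expN_taylor 4) : 0 <= x ^+ 2 / 2 by have := sqr_ge0 x; lra.
  by rewrite /expN_poly horner_poly !big_ord_recr big_ord0 /= /p; lra.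
rewrite -lee_fin excess_split ?(ltW a0)//.
apply: (@le_trans _ _ (c%:E + (F a - F 0)%:E)%E).
  by rewrite -EFinD lee_fin /F le_eqVlt; apply/orP; left; apply/eqP; field.
rewrite -FE leeD2l//; apply: le_integral => //.
- apply: continuous_compact_integrable; first exact: segment_compact.
  by apply: derivable_within_continuous => x _; exact: df.
- apply: continuous_compact_integrable; first exact: segment_compact.
  apply: derivable_within_continuous => x _; apply: derivableM => //.
  by have [] := is_derive_normal_pdf x.
- move=> x; rewrite inE/= in_itv/= => /andP[x0 xa]; rewrite lee_fin normal_pdf01E.
  by rewrite [leRHS]mulrCA ler_wpM2l ?normal_peak_ge0// ler_wpM2l ?subr_ge0.
Qed.

(** From a (x - a) <= exp (a (x - a) - 1) and the exponential moment of order
a. *)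
Lemma excess_tail (a : R) : 0 <= a -> a * excess a <= expR (- (a ^+ 2 / 2) - 1).
Proof.
move=> a0.
have mexp :
    measurable_fun setT (fun x : measurableTypeR R => (expR (a * x))%:E).
  by apply/measurable_EFinP; apply: measurableT_comp => //; exact: measurable_funM.
rewrite -lee_fin EFinM -integral_excess//.
rewrite -ge0_integralZl//; last 2 first.
- by apply/measurable_EFinP; exact: measurable_hinge.
- by move=> x _; rewrite lee_fin hinge_ge0.
have -> : (expR (- (a ^+ 2 / 2) - 1))%:E =
    (\int[gamma]_x ((expR (- a ^+ 2 - 1))%:E * (expR (a * x))%:E))%E.
  rewrite ge0_integralZl//.
  by rewrite normal_mgf -EFinM -expRD; congr (expR _)%:E; field.
apply: ge0_le_integral => //.
- by move=> x _; rewrite mule_ge0// lee_fin hinge_ge0.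
- apply: emeasurable_funM => //; apply/measurable_EFinP; exact: measurable_hinge.
- exact: emeasurable_funM.
- move=> x _; rewrite -!EFinM lee_fin -expRD /hinge /Num.max; case: ifPn => _.
    by rewrite mulr0 expR_ge0.
  by apply: le_trans (expR_ge1Dx _); nra.
Qed.

End excess.

(** * Numerical enclosure of the supremum *)

Section constant.
Context {R : realType}.
Local Notation c := (@normal_peak R 1).

Lemma normal_peak_bounds :
  398 / 10 ^+ 3 + 934 / 10 ^+ 6 <= c <= 398 / 10 ^+ 3 + 95 / 10 ^+ 5.
Proof.
have /andP[pi_ge pi_le] := @pi_bounds R.
have c0 : 0 < c := normal_peak_gt0 (oner_neq0 R).
have c2 : c ^+ 2 = (2 * pi)^-1.
  rewrite /normal_peak exprVn sqr_sqrtr expr1n mul1r ?mulr_natl//.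
  by rewrite mulrn_wge0// pi_ge0.
have pi0 : 0 < 2 * pi :> R by rewrite mulr_gt0 ?pi_gt0.
have le_inv (x y : R) : 0 < y -> x * y <= 1 -> x <= y^-1.
  by move=> y0; rewrite -ler_pdivlMr// mul1r.
have inv_le (x y : R) : 0 < y -> 1 <= x * y -> y^-1 <= x.
  by move=> y0; rewrite -ler_pdivrMr// mul1r.
have [lo0 hi0] : 0 <= 398 / 10 ^+ 3 + 934 / 10 ^+ 6 :> R /\
    0 <= 398 / 10 ^+ 3 + 95 / 10 ^+ 5 :> R by split; lra.
apply/andP; split.
  rewrite -(@ler_pXn2r _ 2) ?nnegrE ?(ltW c0)// c2.
  apply: (le_inv _ _ pi0).
  apply: (@le_trans _ _ ((398 / 10 ^+ 3 + 934 / 10 ^+ 6) ^+ 2 *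
    (2 * (3 + 1417 / 10 ^+ 4)))); last lra.
  by rewrite ler_wpM2l ?sqr_ge0// ler_wpM2l.
rewrite -(@ler_pXn2r _ 2) ?nnegrE ?(ltW c0)// c2.
apply: (inv_le _ _ pi0).
apply: (@le_trans _ _ ((398 / 10 ^+ 3 + 95 / 10 ^+ 5) ^+ 2 *
  (2 * (3 + 1415 / 10 ^+ 4)))); first lra.
by rewrite ler_wpM2l ?sqr_ge0// ler_wpM2l.
Qed.

(** The left-hand side nearly reaches its maximum at m = 0.61, so the difference
is expanded there as (a - m)^2 W + r1 (a - m) + r0. The coefficients of W come
from dividing twice by a - m; W stays above 0.014, which together with r0 > 0
absorbs the small slope r1. *)
Lemma excess_poly_le (a : R) : 0 <= a <= 17 / 10 ->
  (398 / 10 ^+ 3 + 95 / 10 ^+ 5) *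
    (a * (1 + a ^+ 2 / 2 - a ^+ 4 / 24 + a ^+ 6 / 240)) - a ^+ 2 / 2 <=
  101 / 10 ^+ 3 + 25 / 10 ^+ 5.
Proof.
move=> /andP[a0 a17].
pose k : R := 398 / 10 ^+ 3 + 95 / 10 ^+ 5; pose q0 : R := 101 / 10 ^+ 3 + 25 / 10 ^+ 5.
pose m : R := 61 / 100.
pose b6 := - k / 240; pose b5 := m * b6; pose b4 := k / 24 + m * b5.
pose b3 := m * b4; pose b2 := - k / 2 + m * b3; pose b1 := 1 / 2 + m * b2.
pose b0 := - k + m * b1; pose r0 := q0 + m * b0.
pose w4 := b5 + m * b6; pose w3 := b4 + m * w4; pose w2 := b3 + m * w3.
pose w1 := b2 + m * w2; pose w0 := b1 + m * w1; pose r1 := b0 + m * w0.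
set W := w0 + a * (w1 + a * (w2 + a * (w3 + a * (w4 + a * b6)))).
have e : q0 - (k * (a * (1 + a ^+ 2 / 2 - a ^+ 4 / 24 + a ^+ 6 / 240)) - a ^+ 2 / 2) =
    (a - m) ^+ 2 * W + r1 * (a - m) + r0.
  rewrite /W /r1 /r0 /w0 /w1 /w2 /w3 /w4 /b0 /b1 /b2 /b3 /b4 /b5 /b6.
  by field.
have [h0 h1 h2] : [/\ 27 / 100 <= w0, - (1821 / 10 ^+ 4) <= w1 & 187 / 10 ^+ 4 <= w2].
  rewrite /w0 /w1 /w2 /w3 /w4 /b0 /b1 /b2 /b3 /b4 /b5 /b6 /k /m.
  by split; lra.
have [h3 h4 h5] :
    [/\ 147 / 10 ^+ 4 <= w3, - (21 / 10 ^+ 4) <= w4 & - (17 / 10 ^+ 4) <= b6].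
  rewrite /w3 /w4 /b4 /b5 /b6 /k /m.
  by split; lra.
have [hr1 hr1' hr0] : [/\ - (72 / 10 ^+ 5) <= r1, r1 <= 0 & 15 / 10 ^+ 6 <= r0].
  rewrite /r1 /r0 /w0 /w1 /w2 /w3 /w4 /b0 /b1 /b2 /b3 /b4 /b5 /b6 /k /m /q0.
  by split; lra.
have W4 : - (5 / 10 ^+ 3) <= w4 + a * b6 by nra.
have W3 : 0 <= w3 + a * (w4 + a * b6) by nra.
have W2 : 187 / 10 ^+ 4 <= w2 + a * (w3 + a * (w4 + a * b6)) by nra.
have W0 : 14 / 10 ^+ 3 <= W.
  have : w1 + a * (187 / 10 ^+ 4) <= w1 + a * (w2 + a * (w3 + a * (w4 + a * b6))).
    by rewrite lerD2l ler_wpM2l.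
  by move=> /(ler_wpM2l a0); rewrite /W; nra.
rewrite -subr_ge0 e.
have D0 := sqr_ge0 (a - m).
have := ler_wpM2l D0 W0.
have : 0 <= (a - m) ^+ 2 * (14 / 10 ^+ 3) + r1 * (a - m) + 15 / 10 ^+ 6.
  have := sqr_ge0 (28 * (a - m) / 10 ^+ 3 + r1).
  have : r1 ^+ 2 <= (72 / 10 ^+ 5) ^+ 2 by nra.
  lra.
lra.
Qed.

(** Beyond 1.7 the exponential tail is enough. *)
Lemma excess_product_le (a : R) : 0 <= a ->
  a * excess a <= 101 / 10 ^+ 3 + 25 / 10 ^+ 5.
Proof.
move=> a0; have [a17|a17] := leP a (17 / 10); last first.
  apply: le_trans (excess_tail _ a0) _.
  apply: (@le_trans _ _ (expR (- (2 + 445 / 10 ^+ 3)))).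
    by rewrite ler_expR; nra.
  pose x : R := 2 + 445 / 10 ^+ 3; rewrite -/x.
  have /(expN_taylor 9) : 0 <= x by rewrite /x; lra.
  rewrite /expN_poly horner_poly !big_ord_recr big_ord0 /= => H.
  have : expR (- x) <= 1 - x * (1 - x / 2 * (1 - x / 3 * (1 - x / 4 * (1 - x / 5 *
    (1 - x / 6 * (1 - x / 7 * (1 - x / 8))))))) by lra.
  by move=> /le_trans; apply; rewrite /x; lra.
have [->|a_neq0] := eqVneq a 0; first by rewrite mul0r; lra.
have agt0 : 0 < a by rewrite lt_def a_neq0.
have H := excess_le a agt0.
have c0 : 0 < c := normal_peak_gt0 (oner_neq0 R).
have /andP[_ c_le] := normal_peak_bounds.
have Hpoly : a * (1 + a ^+ 2 / 2 - a ^+ 4 / 24 + a ^+ 6 / 240) * c <=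
    a * (1 + a ^+ 2 / 2 - a ^+ 4 / 24 + a ^+ 6 / 240) * (398 / 10 ^+ 3 + 95 / 10 ^+ 5).
  apply: ler_wpM2l => //; apply: mulr_ge0 => //.
  rewrite -(pmulr_rge0 _ c0); apply: le_trans H.
  by rewrite addr_ge0 ?excess_ge0// divr_ge0.
have a_range : 0 <= a <= 17 / 10 by rewrite a0.
have := excess_poly_le a a_range.
have := ler_wpM2l a0 H; lra.
Qed.

(** The level 0.61 is close enough to the maximizer for the value there to clear
the threshold by 8e-6, which leaves room for the errors on pi and on the
exponential. *)
Lemma excess_product_ge : (6363 / 10 ^+ 4) ^+ 2 / 4 <= 61 / 100 * excess (61 / 100 : R).
Proof.
pose a : R := 61 / 100; have a0 : 0 < a by rewrite /a; lra.
have H := excess_ge a a0.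
have /andP[c_ge _] := normal_peak_bounds.
rewrite -/a.
have Hpoly : (398 / 10 ^+ 3 + 934 / 10 ^+ 6) *
    (1 + a ^+ 2 / 2 - a ^+ 4 / 24 + a ^+ 6 / 240 - a ^+ 8 / (48 * 56)) <=
    c * (1 + a ^+ 2 / 2 - a ^+ 4 / 24 + a ^+ 6 / 240 - a ^+ 8 / (48 * 56)).
  by rewrite ler_wpM2r// /a; lra.
have H2 := ler_wpM2l (ltW a0) (le_trans Hpoly H).
apply: (@le_trans _ _ (a * ((398 / 10 ^+ 3 + 934 / 10 ^+ 6) *
    (1 + a ^+ 2 / 2 - a ^+ 4 / 24 + a ^+ 6 / 240 - a ^+ 8 / (48 * 56))) -
    a ^+ 2 / 2)); last lra.
by rewrite /a; lra.
Qed.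

End constant.

(** * Convergence of the constants *)

Section assembly.
Context {R : realType}.

(** By duality, this is a quarter of the limit in probability of the maximum over
the nonempty U of max (sum_U Z_i, 0)^2 / (p |U|). *)
Definition excess_sup : R := sup [set a * excess a | a in [set a : R | 0 <= a]].
Definition posi_limit : R := 2 * Num.sqrt excess_sup.

Let has_sup_excess : has_sup [set a * excess a | a in [set a : R | 0 <= a]].
Proof.
split; first by exists (0 * excess (0 : R)), 0 => //=.
by exists (101 / 10 ^+ 3 + 25 / 10 ^+ 5) => _ [a a0 <-]; exact: excess_product_le.
Qed.

Lemma le_excess_sup (a : R) : 0 <= a -> a * excess a <= excess_sup.
Proof.
by move=> a0; apply: ub_le_sup; [exact: has_sup_excess.2|exists a].
Qed.

Lemma posi_limit_bounds : 6363 / 10 ^+ 4 <= posi_limit < 6364 / 10 ^+ 4.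
Proof.
have S_ge : (6363 / 10 ^+ 4) ^+ 2 / 4 <= excess_sup.
  by apply: le_trans excess_product_ge (le_excess_sup _ _); lra.
have S_le : excess_sup <= 101 / 10 ^+ 3 + 25 / 10 ^+ 5.
  apply: ge_sup; first exact: has_sup_excess.1.
  by move=> _ [a a0 <-]; exact: excess_product_le.
have S0 : 0 <= excess_sup by apply: le_trans S_ge; lra.
have L2 : posi_limit ^+ 2 = 4 * excess_sup.
  by rewrite exprMn sqr_sqrtr//; ring.
have L0 : 0 <= posi_limit by rewrite mulr_ge0 ?sqrtr_ge0.
have n1 : 0 <= 6363 / 10 ^+ 4 :> R by lra.
have n2 : 0 <= 6364 / 10 ^+ 4 :> R by lra.
apply/andP; split.
  have := @ler_pXn2r R 2 isT _ _ n1 L0; rewrite L2 => <-; lra.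
have := @ltr_pXn2r R 2 isT _ _ L0 n2; rewrite L2 => <-; lra.
Qed.

Lemma excess_supE : excess_sup = posi_limit ^+ 2 / 4.
Proof.
have S0 : 0 <= excess_sup.
  by have := le_excess_sup 0 (lexx _); rewrite mul0r.
by rewrite /posi_limit exprMn sqr_sqrtr//; field.
Qed.

Lemma measurable_max_stat_le p (X : 'M[R]_p) j (K : R) :
  measurable [set z | max_stat X j z <= K].
Proof.
rewrite (_ : [set _ | _] =
  (max_stat X j : _ -> measurableTypeR R) @^-1` `]-oo, K]%classic).
  rewrite -[X in measurable X]setTI.
  by apply: (measurable_max_stat X j); [exact: measurableT|exact: measurable_itv].
by apply/seteqP; split => z /=; rewrite in_itv.
Qed.

Lemma PoSI1_const_le p (X : 'M[R]_p) j (alpha K : R)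
    (B : set (p.-tuple (measurableTypeR R))) :
  0 < alpha < 1 -> measurable B -> (std_gauss R p B <= alpha%:E)%E ->
  (forall z, ~ B z -> max_stat X j z <= K) -> PoSI1_const X j alpha <= K.
Proof.
move=> alpha01 mB PB HB; have [_] := PoSI1_const_min X j alpha01; apply.
apply: (@le_trans _ _ (std_gauss R p (~` B))); last first.
  apply: le_measure; rewrite ?inE.
  - exact: measurableC.
  - exact: measurable_max_stat_le.
  - by move=> z /= /HB.
by rewrite probability_setC// EFinB leeB.
Qed.

(** An exceptional set of probability less than 1 - alpha leaves too little room
for the coverage to hold below K. *)
Lemma PoSI1_const_ge p (X : 'M[R]_p) j (alpha K eta : R)
    (B : set (p.-tuple (measurableTypeR R))) :
  0 < alpha < 1 -> measurable B -> (std_gauss R p B <= eta%:E)%E ->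
  eta < 1 - alpha -> (forall z, ~ B z -> K < max_stat X j z) ->
  K <= PoSI1_const X j alpha.
Proof.
move=> alpha01 mB PB etaa HB; have [Hcov _] := PoSI1_const_min X j alpha01.
rewrite leNgt; apply/negP => cK.
have : ((1 - alpha)%:E <= eta%:E)%E.
  apply: le_trans Hcov (le_trans _ PB).
  apply: le_measure; rewrite ?inE//; first exact: measurable_max_stat_le.
  move=> z /= zc; apply: contrapT => /HB; apply/negP; rewrite -leNgt.
  exact: le_trans zc (ltW cK).
by rewrite lee_fin leNgt etaa.
Qed.

Lemma PoSI1_upper (alpha eps : R) : 0 < alpha < 1 -> 0 < eps ->
  \forall n \near \oo, forall c : R, c ^+ 2 < 1 / n.+1%:R ->
    PoSI1_const (orth_design n.+1 c) ord_max alpha / Num.sqrt n.+2%:R <=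
      posi_limit + eps.
Proof.
move=> alpha01 eps0; have /andP[alpha0 _] := alpha01.
(* chosen so that sqrt (S + d) <= sqrt S + eps / 4 *)
pose d := (eps / 4) ^+ 2; have d0 : 0 < d by rewrite exprn_gt0// divr_gt0.
have S0 : 0 <= excess_sup by rewrite excess_supE divr_ge0 ?sqr_ge0.
have eps20 : 0 < eps / 2 by rewrite divr_gt0.
have H := whp_and _ _ (whp_coordinates _ eps20)
  (whp_and _ _ (whp_hinge_uniform false _ _ le_excess_sup d0)
               (whp_hinge_uniform true _ _ le_excess_sup d0)).
have [N _ HN] := H alpha alpha0.
exists N => // n /= Nn c c2.
have [B [mB PB HB]] := HN n.+2 (leq_trans Nn (leq_trans (leqnSn _) (leqnSn _))).
set p : R := n.+2%:R; have p0 : 0 < p :> R by rewrite ltr0n.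
rewrite ler_pdivrMr ?sqrtr_gt0//.
apply: PoSI1_const_le mB PB _ => // z /HB [Hcoord [Hp Hm]].
have mc : n.+1%:R * c ^+ 2 < 1 by rewrite mulrC -ltr_pdivlMr ?ltr0n.
have B0 : 0 <= (excess_sup + d) * p 
  by apply: mulr_ge0; [apply: addr_ge0 => //; exact: ltW|exact: ltW].
apply: le_trans (max_stat_le _ _ _ _ _ mc B0 _ (Hcoord ord_max)) _.
  by case; [exact: Hm|exact: Hp].
rewrite sqrtrM ?addr_ge0 ?(ltW d0)// mulrA -mulrDl ler_wpM2r ?sqrtr_ge0//.
have : Num.sqrt (excess_sup + d) <= Num.sqrt excess_sup + eps / 4.
  rewrite -[leRHS]ger0_norm ?addr_ge0 ?sqrtr_ge0 ?divr_ge0 ?(ltW eps0)//.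
  rewrite -sqrtr_sqr; apply: ler_wsqrtr.
  rewrite sqrrD sqr_sqrtr// -/d lerD2r lerDl mulrn_wge0// mulr_ge0 ?sqrtr_ge0//.
  by rewrite divr_ge0// ltW.
by rewrite /posi_limit; lra.
Qed.

(** Near-optimality of the level a leaves a slack of order d p, which absorbs the
terms a^2 and a |z_p| of [max_stat_ge]. *)
Lemma PoSI1_lower (alpha eps : R) : 0 < alpha < 1 -> 0 < eps ->
  \forall n \near \oo, exists2 c : R, c ^+ 2 < 1 / n.+1%:R &
    posi_limit - eps <=
    PoSI1_const (orth_design n.+1 c) ord_max alpha / Num.sqrt n.+2%:R.
Proof.
move=> alpha01 eps0; have /andP[alpha0 alpha1] := alpha01.
have /andP[L_ge _] := posi_limit_bounds.
set L := posi_limit in L_ge *; have L0 : 0 < L by apply: lt_le_trans L_ge; lra.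
(* the square of L - eps is only comparable to L^2 when L - eps >= 0 *)
wlog epsL : eps eps0 / eps <= L => [hwlog|].
  have [|/ltW Leps] := leP eps L; first exact: hwlog.
  apply: filterS (hwlog L L0 (lexx _)) => n [c c2 Hc]; exists c => //.
  by apply: le_trans Hc; rewrite lerD2l lerN2.
(* (L - eps)^2 <= L^2 - 16 d as soon as eps <= L *)
pose d := L * eps / 16; have d0 : 0 < d by rewrite divr_gt0// mulr_gt0.
have [_ [a a0 <-] aS] := sup_adherent d0 has_sup_excess.
rewrite -/excess_sup excess_supE -/L in aS.
have agt0 : 0 < a.
  rewrite lt_def a0 andbT; apply/eqP => a_eq0; move: aS.
  by rewrite a_eq0 mul0r; apply/negP; rewrite -leNgt /d; nra.
have ad0 : 0 < d / a by rewrite divr_gt0.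
have H := whp_and _ _ (whp_coordinates 1 ltr01) (whp_hinge false _ _ a0 ad0).
have eta0 : 0 < (1 - alpha) / 2 by rewrite divr_gt0// subr_gt0.
have := H _ eta0.
move=> [N1 _ HN1].
have [N2 _ HN2] := nbhs_infty_ger (a ^+ 2 / d).
have [N3 _ HN3] := nbhs_infty_gtr ((a / d) ^+ 2).
exists (maxn N1 (maxn N2 N3)) => // n /=; rewrite !geq_max => /and3P[n1 n2 n3].
have n12 m : (m <= n)%N -> (m <= n.+2)%N.
  by move=> /leq_trans; apply; apply: leq_trans (leqnSn _) (leqnSn _).
have [B [mB PB HB]] := HN1 _ (n12 _ n1).
have /= hn2 := HN2 _ (n12 _ n2); have /= hn3 := HN3 _ (n12 _ n3).
set p : R := n.+2%:R in hn2 hn3 *; have p0 : 0 < p by rewrite ltr0n.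
exists (Num.sqrt p)^-1.
  rewrite exprVn sqr_sqrtr ?(ltW p0)// div1r ltf_pV2 ?posrE ?ltr0n//.
  by rewrite ltr_nat.
have q0 : 0 < Num.sqrt p by rewrite sqrtr_gt0.
have q2 : Num.sqrt p ^+ 2 = p by rewrite sqr_sqrtr// ltW.
rewrite ler_pdivlMr//.
apply: PoSI1_const_ge mB PB _ _ => //; first by lra.
move=> z /HB [Hcoord HT]; rewrite ltNge; apply/negP => HK.
have := max_stat_ge _ _ _ _ agt0 HK.
have := Hcoord ord_max; rewrite mul1r -/p.
have /ler_normlP[HT' _] := HT; move: HT'.
have -> : (fun x : R => hinge a ((-1) ^+ false * x)) = hinge a.
  by apply/funext => x; rewrite expr0 mul1r.
set T := tuple_sum _ z; rewrite -/p => HT' zp Hmax.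
have aT : p * (a * excess a) - d * p <= a * T.
  have ad : a * (d / a) = d by rewrite mulrC divfK ?gt_eqF.
  by have := ler_wpM2l a0 HT'; rewrite [leRHS]mulrA ad; lra.
have a2 : a ^+ 2 <= d * p by rewrite ler_pdivrMr// mulrC in hn2.
have aq : a * Num.sqrt p < d * p.
  have : a / d < Num.sqrt p.
    have ad' : 0 <= a / d by rewrite divr_ge0// ltW.
    by have := @ltr_pXn2r R 2 isT _ _ ad' (ltW q0); rewrite q2 hn3 => <-.
  rewrite ltr_pdivrMr// => aq; rewrite -[X in d * X]q2 expr2 mulrCA mulrA.
  by rewrite ltr_pM2r// mulrC.
have az := ler_wpM2l a0 zp.
have KE : ((L - eps) * Num.sqrt p) ^+ 2 <= (L ^+ 2 - 16 * d) * p.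
  rewrite exprMn q2; apply: ler_wpM2r; [exact: ltW|rewrite /d; nra].
have Hp : p * (L ^+ 2 / 4 - d) < p * (a * excess a) by rewrite ltr_pM2l.
rewrite -/p in Hmax.
lra.
Qed.

End assembly.

Theorem theorem6p2 (R : realType) :
  exists2 L : R, 6363 / 10 ^+ 4 <= L < 6364 / 10 ^+ 4 &
  forall alpha : R, 0 < alpha < 1 ->
    (fun n : nat =>
       ereal_sup [set (PoSI1_const (orth_design n.+1 c) ord_max alpha
                         / Num.sqrt (n.+2)%:R)%:E
                 | c in [set c : R | c ^+ 2 < 1 / (n.+1)%:R]]) @ \oo
      --> L%:E.
Proof.
exists posi_limit; first exact: posi_limit_bounds.
move=> alpha alpha01; set u := fun n : nat => _.
have bounds eps : 0 < eps -> \forall n \near \oo,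
    ((posi_limit - eps)%:E <= u n <= (posi_limit + eps)%:E)%E.
  move=> eps0; apply: filterS2 (PoSI1_lower _ _ alpha01 eps0)
    (PoSI1_upper _ _ alpha01 eps0).
  move=> n [c c2 Hlo] Hup; apply/andP; split.
    apply: (@le_trans _ _ (PoSI1_const (orth_design n.+1 c) ord_max alpha
      / Num.sqrt n.+2%:R)%:E); first by rewrite lee_fin.
    by apply: ereal_sup_ubound; exists c.
  by apply: ge_ereal_sup => _ [c' /= c'2 <-]; rewrite lee_fin Hup.
apply/fine_cvgP; split.
  apply: filterS (bounds 1 ltr01) => n /andP[lo hi].
  rewrite fin_numElt (lt_le_trans _ lo) ?ltNyr//.
  by rewrite (le_lt_trans hi) ?ltry.
apply/cvgrPdist_le => eps eps0; apply: filterS (bounds eps eps0) => n /=.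
case: (u n) => [r| |]//=; rewrite ?leye_eq ?leeNy_eq ?andbF//.
rewrite !lee_fin => /andP[lo hi].
by rewrite ler_distlC; apply/andP; split; lra.
Qed.
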